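(* Let $G$ be a finite group, $k$ an algebraically closed field whose characteristic does not divide the order of $G$, and $c$ an element of the group algebra $kG$. Let $S(c,kG)=\{a\in kG\mid ac=ca\}$. Then $S(c,kG)$ is a cellular $k$-algebra and $S(c,kG)\subseteq kG$ is a separable Frobenius extension.
   Context: Cellular algebra (Graham–Lehrer): let $R$ be a commutative ring with identity. A unitary $R$-algebra $A$ is cellular with cell datum $(P,M,C,\iota)$ if: (C1) $P$ is a finite partially ordered set, and to each $p\in P$ is associated a finite set $M(p)$ such that $\{C^p_{ij}\mid p\in P,\ i,j\in M(p)\}$ is an $R$-basis of $A$; (C2) $\iota:A\to A$ is an $R$-linear anti-automorphism with $\iota^2=\mathrm{id}$ that sends $C^p_{ij}$ to $C^p_{ji}$; (C3) for $a\in A$, $p\in P$, $i,j\in M(p)$, one has $aC^p_{ij}=\sum_{u\in M(p)}r_a(u,i)C^p_{uj}+r'$, where $r_a(u,i)\in R$ does not depend on $j$ and $r'$ is an $R$-linear combination of basis elements $C^q_{st}$ with $q$ strictly smaller than $p$. An algebra is cellular if it has some cell datum. An extension $B\subseteq A$ of rings means that $B$ is a subring of $A$ with the same identity. It is a Frobenius extension if ${}_BA$ is a finitely generated projective left $B$-module and $\mathrm{Hom}_B({}_BA,B)\simeq {}_AA_B$ as $A$-$B$-bimodules. It is separable if the multiplication map $A\otimes_BA\to A$, $x\otimes y\mapsto xy$, is a split surjection of $A$-$A$-bimodules. *)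

(* Defs.v *)
From HB Require Import structures.
From mathcomp Require Import all_boot all_order all_algebra all_fingroup.
From mathcomp Require Import ring_quotient generic_quotient.
From mathcomp Require Import boolp.
From mathcomp Require Import freeg.

Set Implicit Arguments.
Unset Strict Implicit.
Unset Printing Implicit Defensive.

Import GRing.Theory.

Local Open Scope ring_scope.

Section Cellular.
Variables (R : comNzRingType) (A : algType R).

Section CellDatum.
Variables (d : Order.disp_t) (P : finPOrderType d) (M : P -> finType).
Variable C : forall p : P, M p -> M p -> A.

Definition cell_combination (Q : pred P) (r : forall p, M p -> M p -> R) : A :=
  \sum_(p : P | Q p) \sum_(i : M p) \sum_(j : M p) r p i j *: C i j.

Definition cell_basis : Prop :=
  (forall a : A, exists r, a = cell_combination predT r) /\
  (forall r, cell_combination predT r = 0 -> forall p i j, r p i j = 0).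

Definition cell_involution (iota : {linear A -> A}) : Prop :=
  [/\ iota 1 = 1,
      forall x y, iota (x * y) = iota y * iota x,
      involutive iota
    & forall p (i j : M p), iota (C i j) = C j i].

(* [ra] must serve for all [i] and [j], whereas [r'] may depend on both. *)
Definition cell_multiplication : Prop :=
  forall (a : A) (p : P), exists ra : M p -> M p -> R,
    forall i j : M p, exists r' : forall q, M q -> M q -> R,
      a * C i j = \sum_(u : M p) ra u i *: C u j
                  + cell_combination (fun q => (q < p)%O) r'.

End CellDatum.

Definition cellular : Prop :=
  exists (d : Order.disp_t) (P : finPOrderType d) (M : P -> finType)
         (C : forall p : P, M p -> M p -> A) (iota : {linear A -> A}),
    [/\ cell_basis C, cell_involution C iota & cell_multiplication C].

End Cellular.

Definition finitely_generated (R : nzRingType) (M : lmodType R) : Prop :=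
  exists s : seq M, forall x : M, exists c : 'I_(size s) -> R,
    x = \sum_(i < size s) c i *: s`_i.

Definition projective (R : nzRingType) (M : lmodType R) : Prop :=
  forall (U V : lmodType R) (g : {linear U -> V}) (f : {linear M -> V}),
    (forall v, exists u, g u = v) ->
    exists h : {linear M -> U}, forall x, g (h x) = f x.

(** A ring extension is given by a type [B] realising a subring of [A] (with the
    same identity) whose elements are those satisfying [S]; the inclusion of
    [B] in [A] is [val]. *)

Definition left_module (A : nzRingType) (S : pred A) (B : subNzRingType S) :
  Type := A.

Section LeftModule.
Variables (A : nzRingType) (S : pred A) (B : subNzRingType S).

Local Notation left_module := (left_module B).

HB.instance Definition _ := GRing.Zmodule.on left_module.

Definition left_module_scale (b : B) (x : left_module) : left_module :=
  (val b : A) * (x : A).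

Fact left_module_scaleA (b c : B) (x : left_module) :
  left_module_scale b (left_module_scale c x) = left_module_scale (b * c) x.
Proof. by rewrite /left_module_scale rmorphM mulrA. Qed.

Fact left_module_scale1 : left_id 1 left_module_scale.
Proof. by move=> x; rewrite /left_module_scale rmorph1 mul1r. Qed.

Fact left_module_scaleDr : right_distributive left_module_scale +%R.
Proof. by move=> b x y; rewrite /left_module_scale mulrDr. Qed.

Fact left_module_scaleDl (x : left_module) :
  {morph left_module_scale^~ x : b c / b + c}.
Proof. by move=> b c; rewrite /left_module_scale rmorphD mulrDl. Qed.

HB.instance Definition _ := GRing.Zmodule_isLmodule.Build B left_module
  left_module_scaleA left_module_scale1 left_module_scaleDr
  left_module_scaleDl.

(* [Phi] is an isomorphism of A-B-bimodules from A to Hom_B(A, B), on which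
   (a f b) z = f (z a) b. *)
Definition frobenius_iso (Phi : A -> {linear left_module -> B^o}) : Prop :=
  [/\ forall (x y : A) z, Phi (x + y) z = Phi x z + Phi y z,
      forall (a x z : A), Phi (a * x) z = Phi x (z * a),
      forall (x : A) (b : B) z, Phi (x * val b) z = (Phi x z : B) * b
    & forall f : {linear left_module -> B^o}, exists! x : A, Phi x =1 f].

Definition frobenius_extension : Prop :=
  [/\ finitely_generated left_module, projective left_module
    & exists Phi, frobenius_iso Phi].

End LeftModule.

Section Tensor.
Variables (A : nzRingType) (S : pred A) (B : subNzRingType S).

Definition fpair (x y : A) : {freeg (A * A)%type} := Freeg [:: (1, (x, y))].

(* The subgroup of the free abelian group on A * A generated by the relations
   that define the tensor product over B. *)
Inductive tensor_relation : {freeg (A * A)%type} -> Prop :=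
| TensorRelationDl x y z :
    tensor_relation (fpair (x + y) z - (fpair x z + fpair y z))
| TensorRelationDr x y z :
    tensor_relation (fpair x (y + z) - (fpair x y + fpair x z))
| TensorRelationM x (b : B) y :
    tensor_relation (fpair (x * val b) y - fpair x (val b * y))
| TensorRelation0 : tensor_relation 0
| TensorRelationB u v :
    tensor_relation u -> tensor_relation v -> tensor_relation (u - v).

Definition tensor_null : {pred {freeg (A * A)%type}} :=
  fun u => `[< tensor_relation u >].

Fact tensor_null_zmod_closed : zmod_closed tensor_null.
Proof.
split=> [|u v /asboolP Hu /asboolP Hv]; apply/asboolP.
  exact: TensorRelation0.
exact: TensorRelationB.
Qed.

HB.instance Definition _ :=
  GRing.isZmodClosed.Build _ tensor_null tensor_null_zmod_closed.

Definition tensor : Type := Quotient.quot tensor_null.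

HB.instance Definition _ := GRing.Zmodule.on tensor.

Definition tensor_pi : {freeg (A * A)%type} -> tensor :=
  \pi_(Quotient.quot tensor_null)%qT.

Definition pure_tensor (x y : A) : tensor := tensor_pi (fpair x y).

Definition balanced (V : zmodType) (f : A -> A -> V) : Prop :=
  [/\ forall x y z, f (x + y) z = f x z + f y z,
      forall x y z, f x (y + z) = f x y + f x z
    & forall x (b : B) y, f (x * val b) y = f x (val b * y)].

(* When f is balanced, this is the unique additive map that sends every
   [pure_tensor x y] to [f x y]; see [tensor_lift_pure]. *)
Definition tensor_lift (V : zmodType) (f : A -> A -> V) (t : tensor) : V :=
  @fglift int (zmodule V) _ (fun xy => f xy.1 xy.2)
    (repr (t : Quotient.quot tensor_null)).

Definition tensor_mul : tensor -> A := tensor_lift (fun x y => x * y).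

Definition tensor_lact (a : A) : tensor -> tensor :=
  tensor_lift (fun x y => pure_tensor (a * x) y).

Definition tensor_ract (t : tensor) (a : A) : tensor :=
  tensor_lift (fun x y => pure_tensor x (y * a)) t.

Lemma tensor_piP u v : tensor_pi u = tensor_pi v <-> tensor_relation (u - v).
Proof.
have E : (u - v \in tensor_null) = (tensor_pi u == tensor_pi v).
  exact: Quotient.idealrBE.
split=> [/eqP|Huv]; first by rewrite -E => /asboolP.
by apply/eqP; rewrite -E; apply/asboolP.
Qed.

Lemma tensor_reprK (t : tensor) :
  tensor_pi (repr (t : Quotient.quot tensor_null)) = t.
Proof. exact: reprK. Qed.

Lemma tensor_piD u v : tensor_pi (u + v) = tensor_pi u + tensor_pi v.
Proof. exact: (Quotient.pi_add tensor_null). Qed.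

Lemma pure_tensor_balanced : balanced pure_tensor.
Proof.
split=> [x y z|x y z|x b y]; rewrite /pure_tensor -?tensor_piD;
  apply/tensor_piP; by constructor.
Qed.

Section Lift.
Variables (V : zmodType) (f : A -> A -> V).

Local Notation flift := (@fglift int (zmodule V) _ (fun xy => f xy.1 xy.2)).

Hypothesis fB : balanced f.

Let fliftB u v : flift (u - v) = flift u - flift v.
Proof. exact: lift_is_additive. Qed.

Let flift0 : flift 0 = 0.
Proof. by rewrite -[X in flift X](subrr 0) fliftB subrr. Qed.

Let fliftD u v : flift (u + v) = flift u + flift v.
Proof.
have fliftN w : flift (- w) = - flift w by rewrite -sub0r fliftB flift0 sub0r.
by rewrite -{1}[v]opprK fliftB fliftN opprK.
Qed.

Let flift_pair x y : flift (fpair x y) = f x y.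
Proof. by rewrite liftU scale1r. Qed.

Let flift_null u : tensor_relation u -> flift u = 0.
Proof.
case: fB => fDl fDr fM; elim=> [x y z|x y z|x b y||v w _ Hv _ Hw].
- by rewrite fliftB fliftD !flift_pair fDl subrr.
- by rewrite fliftB fliftD !flift_pair fDr subrr.
- by rewrite fliftB !flift_pair fM subrr.
- exact: flift0.
by rewrite fliftB Hv Hw subrr.
Qed.

Lemma tensor_lift_pi u : tensor_lift f (tensor_pi u) = flift u.
Proof.
apply/eqP; rewrite -subr_eq0 -fliftB flift_null //.
by apply/tensor_piP; rewrite tensor_reprK.
Qed.

Lemma tensor_lift_pure x y : tensor_lift f (pure_tensor x y) = f x y.
Proof. by rewrite tensor_lift_pi flift_pair. Qed.

Lemma tensor_liftD t u :
  tensor_lift f (t + u) = tensor_lift f t + tensor_lift f u.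
Proof.
by rewrite -[t]tensor_reprK -[u]tensor_reprK -tensor_piD !tensor_lift_pi fliftD.
Qed.

End Lift.

Lemma tensor_mul_pure x y : tensor_mul (pure_tensor x y) = x * y.
Proof.
apply: (@tensor_lift_pure A (fun x y => x * y)).
by split=> *; rewrite ?mulrDl ?mulrDr ?mulrA.
Qed.

Lemma tensor_lact_pure a x y :
  tensor_lact a (pure_tensor x y) = pure_tensor (a * x) y.
Proof.
case: pure_tensor_balanced => Dl Dr M.
apply: (@tensor_lift_pure _ (fun x y => pure_tensor (a * x) y)).
by split=> *; rewrite ?mulrDr ?Dl ?Dr // mulrA M.
Qed.

Lemma tensor_ract_pure a x y :
  tensor_ract (pure_tensor x y) a = pure_tensor x (y * a).
Proof.
case: pure_tensor_balanced => Dl Dr M.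
apply: (@tensor_lift_pure _ (fun x y => pure_tensor x (y * a))).
by split=> *; rewrite ?mulrDl ?Dl ?Dr // M mulrA.
Qed.

Definition separable_extension : Prop :=
  exists sigma : {additive A -> tensor},
    [/\ forall a x, sigma (a * x) = tensor_lact a (sigma x),
        forall x a, sigma (x * a) = tensor_ract (sigma x) a
      & forall x, tensor_mul (sigma x) = x].

End Tensor.

Section Centralizer.
Variables (R : comNzRingType) (A : algType R) (c : A).

Definition commutes_with : pred A := fun a => a * c == c * a.

Fact commutes_with_subalg_closed : subalg_closed commutes_with.
Proof.
split=> [|r a b|a b]; rewrite ?unfold_in.
- by rewrite mul1r mulr1.
- by move=> /eqP ac /eqP bc; rewrite mulrDl mulrDr -scalerAl -scalerAr ac bc.
by move=> /eqP ac /eqP bc; rewrite -mulrA bc mulrA ac mulrA.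
Qed.

HB.instance Definition _ :=
  GRing.isSubalgClosed.Build R A commutes_with commutes_with_subalg_closed.

Record centralizer : Type :=
  Centralizer { centralizer_val : A; _ : commutes_with centralizer_val }.

HB.instance Definition _ := [isSub for centralizer_val].
HB.instance Definition _ := [Choice of centralizer by <:].
HB.instance Definition _ := [SubChoice_isSubAlgebra of centralizer by <:].

End Centralizer.

Section GroupAlgebra.
Variables (k : fieldType) (G : finGroupType).

(* [f] stands for the formal sum of the [f x] x over the [x : G]; the ring
   structure that {ffun G -> k} itself has is the pointwise one, hence the
   alias. *)
Definition group_algebra : Type := {ffun G -> k}.

HB.instance Definition _ := GRing.Lmodule.copy group_algebra {ffun G -> k^o}.

Implicit Types f g h : group_algebra.

Definition group_algebra_one : group_algebra := [ffun x => (x == 1%g)%:R].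

Definition group_algebra_mul f g : group_algebra :=
  [ffun x => \sum_(y : G) f y * g (y^-1 * x)%g].

Fact group_algebra_mulA : associative group_algebra_mul.
Proof.
move=> f g h; apply/ffunP=> x; rewrite !ffunE.
under eq_bigr do rewrite ffunE mulr_sumr.
under [RHS]eq_bigr do rewrite ffunE mulr_suml.
rewrite [RHS]exchange_big; apply: eq_bigr => y _ /=.
rewrite (reindex_inj (mulgI y^-1%g)); apply: eq_bigr => z _.
by rewrite mulrA invMg invgK mulgA mulgK.
Qed.

Fact group_algebra_mul1l : left_id group_algebra_one group_algebra_mul.
Proof.
move=> f; apply/ffunP=> x; rewrite ffunE (bigD1 1%g) //= big1 => [|y /negPf y1].
  by rewrite ffunE eqxx mul1r invg1 mul1g addr0.
by rewrite ffunE y1 mul0r.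
Qed.

Fact group_algebra_mul1r : right_id group_algebra_one group_algebra_mul.
Proof.
move=> f; apply/ffunP=> x; rewrite ffunE (bigD1 x) //= big1 => [|y /negPf yx].
  by rewrite ffunE mulVg eqxx mulr1 addr0.
by rewrite ffunE -eq_mulVg1 yx mulr0.
Qed.

Fact group_algebra_mulDl : left_distributive group_algebra_mul +%R.
Proof.
move=> f g h; apply/ffunP=> x; rewrite !ffunE -big_split.
by apply: eq_bigr => y _; rewrite !ffunE mulrDl.
Qed.

Fact group_algebra_mulDr : right_distributive group_algebra_mul +%R.
Proof.
move=> f g h; apply/ffunP=> x; rewrite !ffunE -big_split.
by apply: eq_bigr => y _; rewrite !ffunE mulrDr.
Qed.

Fact group_algebra_one_neq0 : group_algebra_one != 0.
Proof.
by apply/eqP=> /ffunP/(_ 1%g)/eqP; rewrite !ffunE eqxx oner_eq0.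
Qed.

HB.instance Definition _ := GRing.Zmodule_isNzRing.Build group_algebra
  group_algebra_mulA group_algebra_mul1l group_algebra_mul1r
  group_algebra_mulDl group_algebra_mulDr group_algebra_one_neq0.

Fact group_algebra_scaleAl (a : k) f g : a *: (f * g) = (a *: f) * g.
Proof.
apply/ffunP=> x; rewrite !ffunE scaler_sumr.
by apply: eq_bigr => y _; rewrite ffunE scalerAl.
Qed.

Fact group_algebra_scaleAr (a : k) f g : a *: (f * g) = f * (a *: g).
Proof.
apply/ffunP=> x; rewrite !ffunE scaler_sumr.
by apply: eq_bigr => y _; rewrite ffunE scalerAr.
Qed.

HB.instance Definition _ := GRing.Lmodule_isLalgebra.Build k group_algebra
  group_algebra_scaleAl.
HB.instance Definition _ := GRing.Lalgebra_isAlgebra.Build k group_algebra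
  group_algebra_scaleAr.

End GroupAlgebra.

(* Main.v *)
(* Over [k], the group algebra is a product of matrix algebras, and a Jordan basis
   for the image of [c] in each factor turns the centralizer of [c] into a product
   of endomorphism algebras of modules k[X]/(X^l_1) + ... + k[X]/(X^l_r), one for
   each pair of a factor and an eigenvalue.

   Cellular: the maps k[X]/(X^l_i) -> k[X]/(X^l) -> k[X]/(X^l_j), the canonical
   surjection followed by the inclusion, form a cell basis whose poset is given by
   l; the involution is the flip of matrices along the block anti-diagonals.

   Frobenius: multiplication on both sides by the Casimir element of the algebra
   generated by [c] and the center is a bimodule map from the group algebra to the
   centralizer, and it admits dual bases made of matrix units, because the largest
   block of each pair is free over k[X]/(X^m).

   Separable: 1/|G| times the sum of the g (x) g^-1 is a separability idempotent
   of the group algebra over k, hence over each intermediate ring. *)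
From HB Require Import structures.
Require Import Defs.
From mathcomp Require Import all_boot all_order all_algebra all_fingroup.
From mathcomp Require Import pgroup mxrepresentation.
From mathcomp Require Import boolp zify.
Set Implicit Arguments.
Unset Strict Implicit.
Unset Printing Implicit Defensive.

Import GRing.Theory.
Local Open Scope ring_scope.

(** * Wedderburn decomposition *)

Section GroupAlgebraRepresentation.
Variables (k : fieldType) (G : finGroupType).

Definition group_algebra_op n (rG : mx_representation k [set: G] n)
  (a : group_algebra k G) : 'M[k]_n := \sum_x a x *: rG x.

Variables (n : nat) (rG : mx_representation k [set: G] n).
Local Notation op := (group_algebra_op rG).

Lemma group_algebra_opP r a b : op (r *: a + b) = r *: op a + op b.
Proof.
rewrite scaler_sumr -big_split; apply: eq_bigr => x _ /=.
by rewrite !ffunE scalerDl scalerA.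
Qed.

Lemma group_algebra_op1 : op 1 = 1%:M.
Proof.
rewrite /op (bigD1 1%g) //= big1 => [|x /negPf x1]; last first.
  by rewrite ffunE x1 scale0r.
by rewrite ffunE eqxx scale1r repr_mx1 addr0.
Qed.

Lemma group_algebra_opM a b : op (a * b) = op a *m op b.
Proof.
rewrite /op mulmx_suml.
under eq_bigr do rewrite ffunE scaler_suml.
rewrite exchange_big; apply: eq_bigr => x _ /=.
rewrite mulmx_sumr (reindex_inj (mulgI x)); apply: eq_bigr => y _ /=.
by rewrite mulKg repr_mxM ?inE // -scalemxAl -scalemxAr scalerA.
Qed.

(** Every representation of [G] factors through the image of the regular one, in which the
    Wedderburn components live. *)
Lemma gring_op_regular a :
  gring_op rG (group_algebra_op (regular_repr k [set: G]) a) = op a.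
Proof.
rewrite /group_algebra_op linear_sum; apply: eq_bigr => x _.
by rewrite linearZ /= gring_opG ?inE.
Qed.

End GroupAlgebraRepresentation.

(** Injectivity: the regular image of [a] splits along the Wedderburn components, and [irr_repr i]
    is injective on the component of [i] and kills the others. Surjectivity: over an algebraically
    closed field each [irr_repr i] maps onto the full matrix algebra, and preimages chosen in
    separate components can be added. *)
Lemma wedderburn (k : closedFieldType) (G : finGroupType) :
  ([pchar k]^'.-group [set: G])%g ->
  exists (I : finType) (n : I -> nat)
         (rho : forall i, mx_representation k [set: G] (n i)),
    (forall a, (forall i, group_algebra_op (rho i) a = 0) -> a = 0) /\
    (forall X : forall i, 'M[k]_(n i), exists a,
       forall i, group_algebra_op (rho i) a = X i).
Proof.
move=> kG'; pose aG := regular_repr k [set: G].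
pose sG : irrType k [set: G] := DecSocleType aG.
exists sG, (@irr_degree _ _ _ sG), (@irr_repr _ _ _ sG).
split=> [a a0 | X].
  have: (group_algebra_op aG a \in group_ring k [set: G])%MS.
    by apply/envelop_mxP; exists a => //; apply: eq_bigl => x; rewrite inE.
  rewrite -(Wedderburn_sum_pchar sG kG') => /memmx_sumsP[A defA RA].
  have A0 i : A i = 0.
    have := @regular_op_inj_pchar _ _ _ sG kG' _ (irr_repr i) (socle_irr i).
    rewrite irr_reprK_pchar //; apply; rewrite ?inE ?linear0 ?sub0mx //.
    rewrite -[RHS](a0 i) -gring_op_regular defA linear_sum (bigD1 i) //=.
    rewrite big1 ?addr0 // => j ji; exact: (irr_repr'_op0_pchar kG' ji (RA j)).
  have {}defA : group_algebra_op aG a = 0 by rewrite defA big1.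
  (* The regular representation is faithful: [gring_proj x] recovers the coefficient of [x]. *)
  apply/ffunP => x; rewrite [RHS]ffunE.
  have := congr1 (gring_proj x) defA; rewrite linear0 /group_algebra_op linear_sum.
  rewrite (bigD1 x) //= big1 => [|y yx].
    rewrite linearZ /= gring_projE ?inE // eqxx addr0 => /matrixP/(_ 0 0).
    by rewrite !mxE mulr1.
  by rewrite linearZ /= gring_projE ?inE // eq_sym (negPf yx) scaler0.
have splitG : group_splitting_field k [set: G] by exact: group_closure_closed_field.
have /fin_all_exists [A XA] : forall i : sG, exists A,
    (A \in Wedderburn_subring i)%MS /\ gring_op (irr_repr i) A = X i.
  move=> i; have irri : mx_irreducible (irr_repr i) := socle_irr i.
  have /andP[_ full] := splitG _ _ irri.
  have: (X i \in enveloping_algebra_mx (irr_repr i))%MS.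
    by rewrite submx_full.
  (* Under [irr_repr i], the component of [i] already has the same image as the whole group ring. *)
  rewrite -(irr_comp_envelop_pchar sG kG' irri) irr_reprK_pchar //.
  case/submxP => D defX; exists (vec_mx (D *m Wedderburn_subring i)).
  rewrite vec_mxK submxMl; split=> //.
  by apply: (can_inj mxvecK); rewrite defX mulmxA -mul_vec_lin vec_mxK.
have: (\sum_i A i \in group_ring k [set: G])%MS.
  rewrite -(Wedderburn_sum_pchar sG kG'); apply/memmx_sumsP.
  by exists A => // i; case: (XA i).
case/envelop_mxP => a defa; exists [ffun x => a x] => i.
rewrite -gring_op_regular -[RHS](XA i).2.
rewrite [group_algebra_op _ _](_ : _ = \sum_i A i).
  rewrite linear_sum (bigD1 i) //= big1 ?addr0 // => j ji.
  exact: (irr_repr'_op0_pchar kG' ji (XA j).1).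
rewrite defa; apply: eq_big => x; rewrite ?inE // => _; by rewrite ffunE.
Qed.

(** * Jordan bases *)

Section JordanBases.
Variables (k : closedFieldType) (n : nat) (c : 'M[k]_n).
Implicit Types (W : 'M[k]_n) (u v w : 'rV[k]_n).

(** By Cayley-Hamilton the product of the linear factors of the characteristic polynomial kills [w].
    Applying the factors one by one, the last nonzero vector is an eigenvector, and it stays in the
    stable space [W]. *)
Lemma exists_eigenvector W : (W *m c <= W)%MS -> W != 0 ->
  exists (a : k) w, [/\ (w <= W)%MS, w != 0 & w *m (c - a%:M) = 0].
Proof.
case: n c W => [|n'] f W Wf; first by rewrite flatmx0 eqxx.
case/rowV0Pn => w wW w0.
have [rs defp] := closed_field_poly_normal (char_poly f).
have: w *m \prod_(z <- rs) (f - z%:M) = 0.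
  have := Cayley_Hamilton f; rewrite defp (eqP (char_poly_monic f)) scale1r.
  rewrite rmorph_prod => /(congr1 (mulmx w)); rewrite mulmx0 => <-.
  by congr (w *m _); apply: eq_bigr => z _; rewrite rmorphB /= horner_mx_X horner_mx_C.
elim: rs w wW w0 {defp} => [|z rs IHrs] w wW w0.
  by rewrite big_nil mulmx1 => w00; rewrite w00 eqxx in w0.
rewrite big_cons -mulmxE mulmxA.
have [wz0 _ | wz0] := eqVneq (w *m (f - z%:M)) 0; first by exists z, w.
apply: IHrs => //; rewrite mulmxBr mul_mx_scalar addmx_sub ?eqmx_opp ?scalemx_sub //.
exact: submx_trans (submxMr f wW) Wf.
Qed.

Lemma stablemx_exp W (a : k) m w : (W *m c <= W)%MS -> (w <= W)%MS ->
  (w *m (c - a%:M) ^+ m <= W)%MS.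
Proof.
move=> Wc wW; elim: m => [|m IHm]; first by rewrite expr0 mulmx1.
rewrite exprSr -mulmxE mulmxA mulmxBr mul_mx_scalar addmx_sub //.
  exact: submx_trans (submxMr c IHm) Wc.
by rewrite eqmx_opp scalemx_sub.
Qed.

(* Fitting: once the chain of kernels of (c - a)^i on W is stationary from m on,
   ker (c - a)^m and W (c - a)^m meet trivially. *)
Lemma exists_splitting_functional W : (W *m c <= W)%MS -> W != 0 ->
  exists (a : k) (m : nat) v (f : 'cV[k]_n),
    [/\ (v <= W)%MS, v *m (c - a%:M) ^+ m.+1 = 0,
        v *m (c - a%:M) ^+ m *m f != 0
      & forall w, (w <= W)%MS -> w *m (c - a%:M) ^+ m.+1 *m f = 0].
Proof.
move=> Wc /(exists_eigenvector Wc)[a [w0 [w0W w0N0 w0N]]]; exists a.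
set N := c - a%:M in w0N *.
pose K i := (W :&: kermx (N ^+ i))%MS.
have inK i w : (w <= K i)%MS = (w <= W)%MS && (w *m N ^+ i == 0).
  by rewrite sub_capmx (sameP sub_kermxP eqP).
have leK i : (K i <= K i.+1)%MS.
  apply/row_subP => r; have := row_sub r (K i); rewrite !inK => /andP[-> /eqP r0].
  by rewrite exprSr -mulmxE mulmxA r0 mul0mx eqxx.
have exK : exists i, (K i.+1 <= K i)%MS.
  apply/not_existsP => ltK.
  have: forall i, (i <= \rank (K i))%N.
    elim=> // i IHi; apply: leq_ltn_trans IHi _; apply: rank_ltmx.
    by rewrite /ltmx leK; apply/negP/ltK.
  by move/(_ n.+1); rewrite leqNgt ltnS rank_leq_row.
case: (ex_minnP exK) => [[|m] Km minm].
  have: (w0 <= K 0)%MS.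
    by apply: submx_trans Km; rewrite inK w0W expr1 w0N eqxx.
  by rewrite inK expr0 mulmx1 (negPf w0N0) andbF.
have /row_subPn[r]: ~~ (K m.+1 <= K m)%MS.
  by apply/negP => /minm; rewrite ltnn.
have := row_sub r (K m.+1); move: (row r _) => v; rewrite !inK.
case/andP=> vW /eqP vm; rewrite vW /= => v0.
(* A preimage of [v *m N ^+ m] under [N ^+ m.+1] in [W] would lie in [K m.+2], hence in [K m.+1],
   which forces [v *m N ^+ m = 0]. *)
have: ~~ (v *m N ^+ m <= W *m N ^+ m.+1)%MS.
  apply/negP => /submxP[D defv].
  have: (D *m W <= K m.+2)%MS.
    rewrite inK submxMl exprSr -mulmxE mulmxA -(mulmxA D) -defv.
    by rewrite -mulmxA mulmxE -exprSr vm eqxx.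
  move/submx_trans/(_ Km); rewrite inK => /andP[_].
  by rewrite -mulmxA -defv (negPf v0).
rewrite submxE => /matrix0Pn[i [j vj]].
(* A column of the cokernel is a functional that vanishes on [W *m N ^+ m.+1]; the column [j] does
   not vanish on [v *m N ^+ m]. *)
exists m, v, (col j (cokermx (W *m N ^+ m.+1))); split=> // [|w /submxP[D ->]].
  rewrite colE mulmxA -colE; apply/matrix0Pn; exists i, 0; by rewrite mxE.
rewrite colE mulmxA -(mulmxA D W) -(mulmxA D (W *m _)) mulmx_coker.
by rewrite mulmx0 mul0mx.
Qed.

(** Each [v j] generates a Jordan chain of length [lam j]; empty chains are allowed. *)
Definition jordan_basis W (J : finType) (lam : J -> nat) (ev : J -> k)
    (v : J -> 'rV[k]_n) :=
  let P := fun j s => v j *m (c - (ev j)%:M) ^+ s in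
  [/\ forall j, (v j <= W)%MS, forall j, P j (lam j) = 0,
      forall alpha : J -> nat -> k,
        \sum_j \sum_(s < lam j) alpha j s *: P j s = 0 ->
        forall j s, (s < lam j)%N -> alpha j s = 0
    & forall w, (w <= W)%MS -> exists alpha : J -> nat -> k,
        w = \sum_j \sum_(s < lam j) alpha j s *: P j s].

(** Induction on the rank: the chain of [v] is split off. Its complement [W'] is the common kernel
    in [W] of the functionals [N ^+ i *m f] with [i <= m]. It is stable because [N ^+ m.+1 *m f]
    vanishes on [W], and it is a complement because these functionals pair with the chain by a
    triangular matrix whose diagonal value is [v *m N ^+ m *m f]. *)
Lemma exists_jordan_basis W : (W *m c <= W)%MS ->
  exists (J : finType) (lam : J -> nat) (ev : J -> k) (v : J -> 'rV[k]_n),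
    jordan_basis W lam ev v.
Proof.
have [r] := ubnP (\rank W); elim: r W => // r IHr W rW Wc.
have [W0 | /(exists_splitting_functional Wc)] := eqVneq W 0.
  exists void, (fun=> 0%N), (fun=> 0), (fun=> 0).
  split=> [[]|[]|? _ []|].
  move=> w; rewrite W0 submx0 => /eqP ->; exists (fun _ _ => 0).
  by rewrite big_pred0 //; case.
case=> a [m [v [f [vW vm vf Wf]]]]; set N := c - a%:M in vm vf Wf.
pose W' := (W :&: kermx (\matrix_(i < n, j < m.+1) (N ^+ j *m f) i 0))%MS.
have inW' w : reflect ((w <= W)%MS /\ forall i, (i < m.+1)%N -> w *m N ^+ i *m f = 0)
                      (w <= W')%MS.
  rewrite sub_capmx; apply: (iffP andP) => -[wW]; [move/sub_kermxP|] => wf; split=> //.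
    move=> i im; apply/rowP => z; rewrite ord1 -mulmxA.
    have := congr1 (fun M : 'rV_m.+1 => M 0 (Ordinal im)) wf.
    rewrite !mxE => wf0; rewrite -[RHS]wf0.
    by apply: eq_bigr => l _; rewrite !mxE.
  apply/sub_kermxP/rowP => i; rewrite mxE [RHS]mxE.
  have := congr1 (fun M : 'rV_1 => M 0 0) (wf i (ltn_ord i)).
  rewrite -mulmxA !mxE => wf0; rewrite -[RHS]wf0.
  by apply: eq_bigr => l _; rewrite !mxE.
have W'W : (W' <= W)%MS by apply: capmxSl.
have W'c : (W' *m c <= W')%MS.
  apply/row_subP => i; rewrite row_mul; have := row_sub i W'.
  move: (row i W') => w /inW'[wW wf]; apply/inW'.
  split=> [|l lm]; first exact: submx_trans (submxMr c wW) Wc.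
  have ->: c = N + a%:M by rewrite subrK.
  rewrite mulmxDr mul_mx_scalar !mulmxDl -!scalemxAl wf // scaler0 addr0.
  rewrite -(mulmxA w) mulmxE -exprS.
  by move: lm; rewrite ltnS leq_eqVlt => /predU1P[->|lm]; [apply: Wf | apply: wf].
have rW' : (\rank W' < r)%N.
  apply: leq_trans (rW : (\rank W <= r)%N); apply: rank_ltmx.
  rewrite /ltmx W'W; apply/negP => /(submx_trans vW)/inW'[_ /(_ m (ltnSn m))/eqP].
  exact/negP.
have vN t : (m < t)%N -> v *m N ^+ t = 0.
  by move=> mt; rewrite -(subnKC mt) exprD -mulmxE mulmxA vm mul0mx.
have NN u i j : u *m N ^+ i *m N ^+ j = u *m N ^+ (i + j).
  by rewrite -mulmxA mulmxE -exprD.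
have [J [lam [ev [v' [v'W' Plam Pfree Pspan]]]]] := IHr W' rW' W'c.
pose P j s := v' j *m (c - (ev j)%:M) ^+ s.
have PW' j s : (P j s <= W')%MS by apply: stablemx_exp.
exists (J + 'I_1)%type, (fun x => if x is inl j then lam j else m.+1),
  (fun x => if x is inl j then ev j else a), (fun x => if x is inl j then v' j else v).
split=> [[j|j]|[j|j]|alpha|w wW] //.
- exact: submx_trans (v'W' j) W'W.
- rewrite big_sumType big_ord1 /= -/N => sum0.
  have alpha0 s : (s < m.+1)%N -> alpha (inr 0) s = 0.
    have [b] := ubnP s; elim: b s => // b IHb s sb sm.
    (* This functional kills [W'] and the chain vectors beyond [s]; the coefficients before [s] are
       0 by induction, so only [alpha (inr 0) s] survives. *)
    have /(congr1 (fun u => u *m N ^+ (m - s) *m f)) := sum0.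
    rewrite !mul0mx !mulmxDl !mulmx_suml big1 => [|j _]; last first.
      rewrite !mulmx_suml big1 // => i _; rewrite -!scalemxAl.
      have /inW'[_ ->] := PW' j i; rewrite ?scaler0 //; exact: leq_subr.
    rewrite add0r (bigD1 (Ordinal sm)) //= big1 => [|i]; last first.
      rewrite -val_eqE /= neq_ltn => /orP[lt|lt].
        by rewrite IHb ?scale0r ?mul0mx //; apply: leq_trans lt sb.
      rewrite -!scalemxAl NN vN ?mul0mx ?scaler0 //.
      by rewrite addnBA // ltn_subRL ltn_add2r.
    rewrite addr0 -!scalemxAl NN subnKC // => /eqP.
    by rewrite scaler_eq0 (negPf vf) orbF => /eqP.
  have: \sum_j \sum_(s < lam j) alpha (inl j) s *: P j s = 0.
    rewrite -[RHS]sum0 [X in _ = _ + X]big1 ?addr0 // => s _.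
    by rewrite alpha0 ?scale0r.
  move/(Pfree (fun j => alpha (inl j))) => {}sum0 [j|j] s; first exact: sum0.
  by rewrite ord1; apply: alpha0.
suff [alpha [w' w'W' ->]] : exists alpha : nat -> k, exists2 w', (w' <= W')%MS
    & w = w' + \sum_(s < m.+1) alpha s *: (v *m N ^+ s).
  have [beta ->] := Pspan w' w'W'.
  exists (fun x => if x is inl j then beta j else alpha).
  by rewrite big_sumType big_ord1.
have: forall i, (m.+1 <= i)%N -> w *m N ^+ i *m f = 0.
  move=> i mi; rewrite -(subnK mi) -NN Wf //; exact: stablemx_exp.
(* Induction on the exponent [i] from which on [w *m N ^+ l *m f] vanishes: subtracting a multiple
   of [v *m N ^+ (m - i)] kills the value at [i] and keeps the later ones at 0. For [i = 0] the
   vector is in [W']. *)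
move: (leqnn m.+1); move: {1 3}m.+1 => i.
elim: i w wW => [|i IHi] w wW im wf.
  exists (fun=> 0), w; first by apply/inW'; split=> // i _; apply: wf.
  by rewrite big1 ?addr0 // => s _; rewrite scale0r.
pose b := (w *m N ^+ i *m f) 0 0 / (v *m N ^+ m *m f) 0 0.
have im' : (m - i < m.+1)%N by rewrite ltnS leq_subr.
have [||l il|alpha [w' w'W' defw]] := IHi (w - b *: (v *m N ^+ (m - i))).
- by rewrite addmx_sub // eqmx_opp scalemx_sub // stablemx_exp.
- exact: ltnW.
- rewrite !mulmxBl -!scalemxAl NN.
  move: il; rewrite leq_eqVlt => /predU1P[<-|il].
    rewrite subnK // [X in X - _]mx11_scalar [X in _ - _ *: X]mx11_scalar.
    rewrite scale_scalar_mx divfK ?subrr //.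
    by apply: contra_neq vf => vf; rewrite [LHS]mx11_scalar vf raddf0.
  by rewrite wf // vN ?mul0mx ?scaler0 ?subr0 // -ltn_subLR // subKn.
exists (fun s => alpha s + b *+ (s == m - i)%N), w' => //.
under eq_bigr do rewrite scalerDl.
rewrite big_split addrA /= -defw [X in _ + X](bigD1 (Ordinal im')) //= eqxx.
rewrite big1 ?addr0 ?subrK // => s.
by rewrite -val_eqE /= => /negPf ->; rewrite scale0r.
Qed.

End JordanBases.

(** * Jordan coordinates *)

Lemma sum_delta (R : pzSemiRingType) (J : finType) (lam : J -> nat)
  (F : J -> nat -> R) j t :
  \sum_m \sum_(u < lam m) ((m == j) && (u == t :> nat))%:R * F m u =
  F j t *+ (t < lam j)%N.
Proof.
rewrite (bigD1 j) //= addrC big1 => [|m /negPf mj]; last first.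
  by rewrite big1 // => u _; rewrite mj mul0r.
rewrite add0r eqxx; case: ltnP => [tj | jt].
  rewrite (bigD1 (Ordinal tj)) //= eqxx mul1r big1 ?addr0 // => u.
  by rewrite -val_eqE /= => /negPf ->; rewrite mul0r.
rewrite big1 // => u _.
by rewrite /= ltn_eqF ?mul0r //; apply: leq_trans jt.
Qed.
Arguments sum_delta {R J lam} F j t.

(* Coordinates that identify [A] with the matrices indexed by the pairs (i, s)
   with [s < jsize i] whose entries vanish between blocks of different
   components, and [c] with a direct sum of Jordan blocks.  Indices out of
   range are allowed and give the coordinate 0. *)
Record jordan_coordinates (k : fieldType) (A : algType k) (c : A) :=
  JordanCoordinates {
  jblock : finType;
  jcomponent : eqType;
  jcomp : jblock -> jcomponent;
  jsize : jblock -> nat;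
  jeigen : jblock -> k;
  jcoord : A -> jblock -> nat -> jblock -> nat -> k;
  jmat : (jblock -> nat -> jblock -> nat -> k) -> A;
  jcoordP : forall r a b i s j t,
    jcoord (r *: a + b) i s j t = r * jcoord a i s j t + jcoord b i s j t;
  jcoord1 : forall i s j t,
    jcoord 1 i s j t = [&& i == j, s == t & (s < jsize i)%N]%:R;
  jcoordM : forall a b i s j t,
    jcoord (a * b) i s j t =
    \sum_m \sum_(u < jsize m) jcoord a i s m u * jcoord b m u j t;
  jcoord_out : forall a i s j t,
    ~~ [&& jcomp i == jcomp j, (s < jsize i)%N & (t < jsize j)%N] ->
    jcoord a i s j t = 0;
  jcoord_inj : forall a b,
    (forall i s j t, jcoord a i s j t = jcoord b i s j t) -> a = b;
  jmatE : forall X i s j t, jcoord (jmat X) i s j t =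
    X i s j t *+ [&& jcomp i == jcomp j, (s < jsize i)%N & (t < jsize j)%N];
  jcoordc : forall i s j t,
    jcoord c i s j t = jeigen i * jcoord 1 i s j t + jcoord 1 i s.+1 j t
}.

Section JordanCoordinatesTheory.
Variables (k : fieldType) (A : algType k) (c : A) (S : jordan_coordinates c).

Local Notation J := (jblock S).
Local Notation comp := (@jcomp _ _ _ S).
Local Notation lam := (@jsize _ _ _ S).
Local Notation ev := (@jeigen _ _ _ S).
Local Notation phi := (@jcoord _ _ _ S).
Local Notation mat := (@jmat _ _ _ S).

Lemma jcoord0 i s j t : phi 0 i s j t = 0.
Proof. by rewrite -[0](addNr 0) -scaleN1r jcoordP mulN1r addNr. Qed.

Lemma jcoordD a b i s j t : phi (a + b) i s j t = phi a i s j t + phi b i s j t.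
Proof. by rewrite -[a]scale1r jcoordP mul1r scale1r. Qed.

Lemma jcoordZ r a i s j t : phi (r *: a) i s j t = r * phi a i s j t.
Proof. by rewrite -[r *: a]addr0 jcoordP jcoord0 addr0. Qed.

Lemma jcoordB a b i s j t : phi (a - b) i s j t = phi a i s j t - phi b i s j t.
Proof. by rewrite jcoordD -scaleN1r jcoordZ mulN1r. Qed.

Lemma jcoord_sum (I : Type) (r : seq I) (P : pred I) F i s j t :
  phi (\sum_(x <- r | P x) F x) i s j t = \sum_(x <- r | P x) phi (F x) i s j t.
Proof.
by apply: (big_morph (fun a => phi a i s j t)) => [a b|]; rewrite ?jcoord0 ?jcoordD.
Qed.

Lemma jcoord_comp a i s j t : comp i != comp j -> phi a i s j t = 0.
Proof. by move=> ij; rewrite jcoord_out // (negPf ij). Qed.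

Lemma jcoord_outl a i s j t : (lam i <= s)%N -> phi a i s j t = 0.
Proof. by move=> si; rewrite jcoord_out // [(s < _)%N]ltnNge si andbF. Qed.

Lemma jcoord_outr a i s j t : (lam j <= t)%N -> phi a i s j t = 0.
Proof. by move=> tj; rewrite jcoord_out // [(t < _)%N]ltnNge tj !andbF. Qed.

(** A matrix unit, or 0 if an index is out of range or the two blocks lie in different
    components. *)
Definition junit i s j t : A :=
  mat (fun i' s' j' t' => [&& i' == i, s' == s :> nat, j' == j & t' == t :> nat]%:R).

Lemma junitE i s j t i' s' j' t' :
  phi (junit i s j t) i' s' j' t' =
  [&& [&& i' == i & s' == s :> nat], [&& j' == j & t' == t :> nat],
      comp i == comp j, (s < lam i)%N & (t < lam j)%N]%:R.
Proof.
rewrite jmatE -mulrnA mulnb; congr (_%:R); congr nat_of_bool.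
by case: (eqVneq i' i) => [->|]; case: (eqVneq j' j) => [->|]; rewrite ?andbF //=;
   case: (eqVneq s' s) => [->|]; case: (eqVneq t' t) => [->|]; rewrite ?andbF.
Qed.

Lemma jcoordM_unit a i s j t i' s' j' t' :
  phi (a * junit i s j t) i' s' j' t' =
  phi a i' s' i s *+
    [&& j' == j & t' == t :> nat] *+ [&& comp i == comp j & (t < lam j)%N].
Proof.
rewrite jcoordM.
under eq_bigr => m _ do under eq_bigr => u _ do
  rewrite junitE -mulnb natrM mulrC -mulrA.
rewrite (sum_delta (fun m u => _ * phi a i' s' m u)).
case: (ltnP s (lam i)) => [si | si]; last first.
  by rewrite mulr0n [in RHS]jcoord_outr ?mul0rn.
rewrite mulr1n /= mulr_natl -mulrnA mulnb; congr (_ *+ nat_of_bool _).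
Qed.

Lemma jcoord_unitM a i s j t i' s' j' t' :
  phi (junit i s j t * a) i' s' j' t' =
  phi a j t j' t' *+
    [&& i' == i & s' == s :> nat] *+ [&& comp i == comp j & (s < lam i)%N].
Proof.
rewrite jcoordM.
under eq_bigr => m _ do under eq_bigr => u _ do
  rewrite junitE andbCA -mulnb natrM -mulrA.
rewrite (sum_delta (fun m u => _ * phi a m u j' t')).
case: (ltnP t (lam j)) => [tj | tj]; last first.
  by rewrite mulr0n [in RHS]jcoord_outl ?mul0rn.
rewrite mulr1n /= andbT mulr_natl -mulrnA mulnb; congr (_ *+ nat_of_bool _).
Qed.

Definition jdiag (f : J -> k) : A :=
  mat (fun i s j t => f i *+ [&& i == j & s == t :> nat]).

Lemma jdiagM f a i s j t : phi (jdiag f * a) i s j t = f i * phi a i s j t.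
Proof.
rewrite jcoordM.
transitivity (\sum_m \sum_(u < lam m)
   ((m == i) && (u == s :> nat))%:R * (f i * phi a m u j t)).
  apply: eq_bigr => m _; have [<-{m}|im] := eqVneq i m; apply: eq_bigr => u _.
    rewrite jmatE !eqxx; case: (eqVneq s u) => [->|_].
      by rewrite ltn_ord !mulr1n mul1r.
    by rewrite mul0rn !mul0r.
  by rewrite jmatE (negPf im) mul0rn !mul0r.
rewrite (sum_delta (fun m u => f i * phi a m u j t)); case: ltnP => // si.
by rewrite jcoord_outl ?mulr0.
Qed.

Lemma jcoordM_diag f a i s j t : phi (a * jdiag f) i s j t = f j * phi a i s j t.
Proof.
rewrite jcoordM.
transitivity (\sum_m \sum_(u < lam m)
   ((m == j) && (u == t :> nat))%:R * (f j * phi a i s m u)).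
  apply: eq_bigr => m _; have [->{m}|mj] := eqVneq m j; apply: eq_bigr => u _.
    rewrite jmatE !eqxx; case: (eqVneq (u : nat) t) => [<-|_].
      by rewrite ltn_ord !mulr1n mul1r mulrC.
    by rewrite mul0rn mulr0 mul0r.
  by rewrite jmatE (negPf mj) mul0rn mulr0 mul0r.
rewrite (sum_delta (fun m u => f j * phi a i s m u)); case: ltnP => // tj.
by rewrite jcoord_outr ?mulr0.
Qed.

Lemma jcoord_cM a i s j t :
  phi (c * a) i s j t = ev i * phi a i s j t + phi a i s.+1 j t.
Proof.
rewrite jcoordM.
under eq_bigr => m _ do under eq_bigr => u _ do rewrite jcoordc mulrDl -mulrA.
under eq_bigr => m _ do rewrite big_split -mulr_sumr /=.
rewrite big_split -mulr_sumr /= -!jcoordM mul1r //.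
Qed.

(** The nilpotent part of [c]: on the left it shifts rows within each block, on the right it shifts
    columns. *)
Definition jnil : A := c - jdiag ev.

Lemma jcoord_nilM a i s j t : phi (jnil * a) i s j t = phi a i s.+1 j t.
Proof. by rewrite mulrBl jcoordB jcoord_cM jdiagM addrAC subrr add0r. Qed.

Lemma jcoordM_nil a i s j t :
  phi (a * jnil) i s j t.+1 = phi a i s j t *+ (t.+1 < lam j)%N.
Proof.
rewrite jcoordM.
transitivity (\sum_m \sum_(u < lam m)
   ((m == j) && (u == t :> nat))%:R * (phi a i s m u *+ (t.+1 < lam j)%N)).
  apply: eq_bigr => m _; have [->{m}|mj] := eqVneq m j; apply: eq_bigr => u _.
    rewrite -[jnil]mulr1 jcoord_nilM jcoord1 eqxx eqSS.
    case: (eqVneq (u : nat) t) => [->|_]; rewrite /= ?mulr0n ?mul1r ?mulr_natr //.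
    by rewrite mulr0 mul0r.
  by rewrite -[jnil]mulr1 jcoord_nilM jcoord1 (negPf mj) mul0r mulr0.
rewrite (sum_delta (fun m u => phi a i s m u *+ _)).
by case: (ltnP t.+1) => [/ltnW -> // | _]; rewrite !mulr0n mul0rn.
Qed.

Lemma jcoordM_nil0 a i s j : phi (a * jnil) i s j 0 = 0.
Proof.
rewrite jcoordM big1 // => m _; rewrite big1 // => u _.
by rewrite -[jnil]mulr1 jcoord_nilM jcoord1 andbF mulr0.
Qed.

Lemma jcoord_nilXM p a i s j t :
  phi (jnil ^+ p * a) i s j t = phi a i (s + p)%N j t.
Proof.
elim: p s => [|p IHp] s; first by rewrite mul1r addn0.
by rewrite exprS -mulrA jcoord_nilM IHp addSnnS.
Qed.

(** The guard [q <= t] corrects the truncated subtraction; [t < lam j] is there because [t - q] can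
    be in range when [t] is not. *)
Lemma jcoordM_nilX q a i s j t :
  phi (a * jnil ^+ q) i s j t =
  phi a i s j (t - q)%N *+ [&& (q <= t)%N & (t < lam j)%N].
Proof.
elim: q t => [|q IHq] t.
  by rewrite mulr1 subn0 leq0n; case: ltnP => //= /jcoord_outr ->.
rewrite exprSr mulrA; case: t => [|t]; first by rewrite jcoordM_nil0.
rewrite jcoordM_nil IHq subSS ltnS.
by case: (ltnP t.+1) => [/ltnW -> // |]; rewrite !andbF // mulr0n.
Qed.

End JordanCoordinatesTheory.

(** * The centralizer in Jordan coordinates *)

Section JordanCentralizer.
Variables (k : fieldType) (A : algType k) (c : A) (S : jordan_coordinates c).

Local Notation J := (jblock S).
Local Notation comp := (@jcomp _ _ _ S).
Local Notation lam := (@jsize _ _ _ S).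
Local Notation ev := (@jeigen _ _ _ S).
Local Notation phi := (@jcoord _ _ _ S).
Local Notation mat := (@jmat _ _ _ S).
Local Notation N := (jnil S).
Local Notation diag := (@jdiag _ _ _ S).

(** Each class of this relation yields one of the endomorphism algebras that make up the
    centralizer. *)
Definition jlinked (i j : J) := (comp i == comp j) && (ev i == ev j).

Lemma jlinked_refl i : jlinked i i.
Proof. by rewrite /jlinked !eqxx. Qed.

Lemma jlinked_sym i j : jlinked i j = jlinked j i.
Proof. by rewrite /jlinked eq_sym [ev i == _]eq_sym. Qed.

Lemma jlinked_left i j : jlinked i j -> jlinked i =1 jlinked j.
Proof. by case/andP => /eqP ij /eqP eij h; rewrite /jlinked ij eij. Qed.

(* Depends only on the class of [j] for [jlinked], so it also labels that class. *)
Definition jlead j : J :=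
  odflt j [pick i | jlinked i j & [forall h, jlinked h j ==> (lam h <= lam i)%N]].

Lemma jleadP j : jlinked (jlead j) j /\
  forall h, jlinked h j -> (lam h <= lam (jlead j))%N.
Proof.
rewrite /jlead; case: pickP => [i /andP[ij /forallP lami] | nolead].
  by split=> // h hj; apply: implyP hj.
have [i ij lami] := arg_maxnP lam (jlinked_refl j).
have := nolead i; rewrite jlinked_sym ij /= => /negbT/negP[].
by apply/forall_inP => h; rewrite jlinked_sym; apply: lami.
Qed.

Lemma jlead_eq i j : (jlead i == jlead j) = jlinked i j.
Proof.
have [[li _] [lj _]] := (jleadP i, jleadP j).
apply/eqP/idP => [eq_l | ij].
  by rewrite -(jlinked_left li) eq_l.
rewrite /jlead; have eqij h : jlinked h i = jlinked h j.
  by rewrite jlinked_sym (jlinked_left ij) jlinked_sym.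
rewrite (@eq_pick _ _ (fun i => jlinked i j &&
  [forall h, jlinked h j ==> (lam h <= lam i)%N])).
  case: pickP => //= nolead; have [l1 l2] := jleadP j.
  by have := nolead (jlead j); rewrite l1; case/forall_inP.
move=> h /=; rewrite eqij; congr (_ && _); apply: eq_forallb => x.
by rewrite eqij.
Qed.

Lemma jlead_id j : jlead (jlead j) = jlead j.
Proof. by apply/eqP; rewrite jlead_eq; case: (jleadP j). Qed.

Section Commuting.
Variables (b : A).
Hypothesis bc : b * c = c * b.

(** Comparing coordinates in [b * c = c * b] writes [(ev i - ev j) * phi b i s j t] through the
    entry one column before and the entry one row after. Both vanish by induction, upwards on [t]
    and, inside, downwards on [s]. *)
Lemma cent_coord_eigen i s j t : ev i != ev j -> phi b i s j t = 0.
Proof.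
move=> ij; have eq0 s' t' : phi b i s'.+1 j t' = 0 -> phi (b * N) i s' j t' = 0 ->
    phi b i s' j t' = 0.
  move=> b1 b2; have := jcoord_cM (S := S) b i s' j t'.
  rewrite -bc -[c in b * c](subrK (diag ev)) mulrDr jcoordD b2 b1 add0r addr0.
  rewrite jcoordM_diag => /eqP; rewrite -subr_eq0 -mulrBl mulf_eq0 subr_eq0 eq_sym.
  by rewrite (negPf ij) => /eqP.
elim: t s => [|t IHt] s; have [d] := ubnP (lam i - s); elim: d s => // d IHd s sd.
  all: have [si | si] := leqP (lam i) s; first exact: jcoord_outl.
  all: apply: eq0; first by apply: IHd; lia.
  exact: jcoordM_nil0.
by rewrite jcoordM_nil IHt mul0rn.
Qed.

Lemma cent_coord_linked i s j t : ~~ jlinked i j -> phi b i s j t = 0.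
Proof.
by rewrite negb_and => /orP[/jcoord_comp -> | /cent_coord_eigen ->].
Qed.

Lemma cent_diag f : (forall i j, jlinked i j -> f i = f j) ->
  b * diag f = diag f * b.
Proof.
move=> eqf; apply: (@jcoord_inj _ _ _ S) => i s j t.
rewrite jdiagM jcoordM_diag; have [/eqf -> // | ij] := boolP (jlinked i j).
by rewrite cent_coord_linked // !mulr0.
Qed.

Lemma cent_nil : b * N = N * b.
Proof.
by rewrite mulrBl mulrBr bc cent_diag // => i j /andP[_ /eqP].
Qed.

Lemma cent_nilX p : b * N ^+ p = N ^+ p * b.
Proof. by apply: commrX; apply: cent_nil. Qed.

(** The blocks of [b] are Toeplitz: commuting with [N ^+ s] carries row [s] to row 0. *)
Lemma cent_coord_row0 i s j t :
  phi b i s j t = phi b i 0 j (t - s) *+ [&& (s <= t)%N & (t < lam j)%N].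
Proof. by rewrite -jcoordM_nilX cent_nilX jcoord_nilXM. Qed.

(** [N ^+ lam i] kills the rows of block [i], while right multiplication by it moves column [t] to
    column [t + lam i], still inside block [j]. *)
Lemma cent_coord_support i j t : (t + lam i < lam j)%N -> phi b i 0 j t = 0.
Proof.
move=> tij; have := jcoordM_nilX (S := S) (lam i) b i 0 j (t + lam i).
rewrite addnK leq_addl tij cent_nilX jcoord_nilXM jcoord_outl //.
Qed.

End Commuting.

(** The remaining free entries of row 0 number the minimum of [lam i] and [lam j], the dimension of
    the space of homomorphisms between the two cyclic modules. *)
Lemma cent_ext a b : a * c = c * a -> b * c = c * b ->
  (forall i j t, jlinked i j -> (t < lam j)%N -> (lam j <= t + lam i)%N ->
     phi a i 0 j t = phi b i 0 j t) -> a = b.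
Proof.
move=> ac bc ab; apply: (@jcoord_inj _ _ _ S) => i s j t.
rewrite (cent_coord_row0 ac) (cent_coord_row0 bc).
case: andP => // -[st tj]; congr (_ *+ _).
have [ij | ij] := boolP (jlinked i j); last by rewrite !cent_coord_linked.
have tsj : (t - s < lam j)%N by lia.
have [tij | tij] := leqP (lam j) (t - s + lam i)%N; first exact: ab.
by rewrite !cent_coord_support.
Qed.

(* The homomorphism k[X]/(X^(lam i)) -> k[X]/(X^(lam j)) between the two blocks
   whose image has length [l.+1].  With lengths as exponents, these elements
   satisfy C^l_(i, j) * C^m_(j, h) = C^(l + m - lam j)_(i, h). *)
Definition jcell l i j : A :=
  mat (fun i' s j' t => [&& i' == i, j' == j & t + l.+1 == lam j + s]%N%:R).

(** The bound on [s] is automatic: [t < lam j] and [t + l.+1 = lam j + s] give [s <= l]. *)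
Lemma jcellE l i j i' s j' t : jlinked i j -> (l < lam i)%N ->
  phi (jcell l i j) i' s j' t =
  [&& i' == i, j' == j, t + l.+1 == lam j + s & t < lam j]%N%:R.
Proof.
move=> /andP[ij _] li; rewrite jmatE -mulrnA mulnb; congr (nat_of_bool _)%:R.
apply/idP/idP => [/andP[/and3P[-> /eqP -> ->] /and3P[_ _ ->]] | ].
  by rewrite eqxx.
case/and4P => /eqP -> /eqP -> tl tj; rewrite !eqxx tl tj ij /=.
by move/eqP: tl => tl; lia.
Qed.

Lemma jcell_cent l i j : jlinked i j -> (l < lam i)%N -> (l < lam j)%N ->
  jcell l i j * c = c * jcell l i j.
Proof.
move=> ij li lj; apply: (@jcoord_inj _ _ _ S) => i' s j' t.
have [tj | tj] := leqP (lam j') t; first by rewrite !jcoord_outr.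
rewrite jcoord_cM -[c in _ * c](subrK (diag ev)) mulrDr jcoordD jcoordM_diag addrC.
congr (_ + _); rewrite ?jcellE //.
  case: eqVneq => [->|_]; last by rewrite !mulr0.
  case: eqVneq => [->|_]; last by rewrite !mulr0.
  by case/andP: ij => _ /eqP ->.
(* In column 0 the shifted row would require [l.+1 = lam j + s.+1], which [l < lam j] excludes. *)
case: t tj => [|t] tj.
  by rewrite jcoordM_nil0 add0n; case: eqP => //; case: eqP => //=; case: eqP => //; lia.
rewrite jcoordM_nil jcellE // tj mulr1n; congr (nat_of_bool _)%:R.
congr (_ && _); have [j'j /=|//] := eqVneq j' j.
by move: tj; rewrite j'j; lia.
Qed.

Lemma jcell_cent_admissible l i j :
  [&& jlinked i j, (l < lam i)%N & (l < lam j)%N] -> commutes_with c (jcell l i j).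
Proof. by case/and3P => ij li lj; apply/eqP/jcell_cent. Qed.

(* The transpose with respect to the anti-diagonal of each block: unlike the plain
   transpose, it fixes [c]. *)
Definition jflip a : A :=
  mat (fun i s j t => phi a j (lam j - t.+1)%N i (lam i - s.+1)%N).

Lemma jflipE a i s j t : phi (jflip a) i s j t =
  phi a j (lam j - t.+1)%N i (lam i - s.+1)%N *+ [&& (s < lam i)%N & (t < lam j)%N].
Proof.
rewrite jmatE; have [ij // | ij] := boolP (comp i == comp j).
by rewrite jcoord_comp ?mul0rn // eq_sym.
Qed.

Lemma jflip_linear r a b : jflip (r *: a + b) = r *: jflip a + jflip b.
Proof.
apply: (@jcoord_inj _ _ _ S) => i s j t.
by rewrite jcoordP !jflipE jcoordP mulrnDl mulrnAr.
Qed.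

Lemma jflipK : involutive jflip.
Proof.
move=> a; apply: (@jcoord_inj _ _ _ S) => i s j t; rewrite !jflipE -mulrnA mulnb.
have [si | si] := ltnP s (lam i); last by rewrite !andbF mulr0n jcoord_outl.
have [tj | tj] := ltnP t (lam j); last by rewrite !andbF mulr0n jcoord_outr.
rewrite (_ : [&& _, _ & _] = true) ?mulr1n; last by lia.
by congr (phi _ _ _ _ _); lia.
Qed.

Lemma jflip1 : jflip 1 = 1.
Proof.
apply: (@jcoord_inj _ _ _ S) => i s j t; rewrite jflipE !jcoord1.
rewrite -mulrnA mulnb; congr (nat_of_bool _)%:R.
by rewrite eq_sym; have [-> /=|] := eqVneq i j; lia.
Qed.

Lemma jflipM a b : jflip (a * b) = jflip b * jflip a.
Proof.
apply: (@jcoord_inj _ _ _ S) => i s j t; rewrite jflipE !jcoordM.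
have [si | si] := ltnP s (lam i); last first.
  rewrite mulr0n big1 // => m _; rewrite big1 // => u _.
  by rewrite jcoord_outl // mul0r.
have [tj | tj] := ltnP t (lam j); last first.
  rewrite mulr0n big1 // => m _; rewrite big1 // => u _.
  by rewrite [phi _ _ _ j t]jcoord_outr // mulr0.
rewrite mulr1n; apply: eq_bigr => m _.
rewrite (reindex_inj rev_ord_inj); apply: eq_bigr => u _ /=.
by rewrite !jflipE si tj ltn_ord !mulr1n mulrC.
Qed.

Lemma jflipc : jflip c = c.
Proof.
apply: (@jcoord_inj _ _ _ S) => i s j t; rewrite jflipE !jcoordc !jcoord1.
have [-> | ij] := eqVneq i j; last by rewrite /= !mulr0n !mulr0 !addr0 mul0rn.
rewrite /= mulrnDl -mulrnAr -!mulrnA !mulnb.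
by congr (_ * (nat_of_bool _)%:R + (nat_of_bool _)%:R); lia.
Qed.

End JordanCentralizer.

(** * Cellular structure *)

Section JordanCellular.
Variables (k : fieldType) (A : algType k) (c : A) (S : jordan_coordinates c).

Local Notation J := (jblock S).
Local Notation lam := (@jsize _ _ _ S).
Local Notation phi := (@jcoord _ _ _ S).

Lemma centralizerP (b : centralizer c) : val b * c = c * val b.
Proof. by case: b => b /= /eqP. Qed.

(** A class of linked blocks, encoded by the rank of its lead, and an image length minus 1. Pairs
    that fit no block get an empty set [jcells]. *)
Definition jindex : finPOrderType _ := ('I_#|J| *p 'I_(\max_j lam j)%N)%type.
Implicit Types p q : jindex.

Definition jcells p : finType :=
  {j : J | (enum_rank (jlead j) == p.1) && (p.2 < lam j)%N}.

Lemma jcells_admissible p (i j : jcells p) :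
  [&& jlinked (val i) (val j), p.2 < lam (val i) & p.2 < lam (val j)]%N.
Proof.
case: i j => [i /= /andP[/eqP ip ->]] [j /= /andP[/eqP jp ->]].
by rewrite !andbT -jlead_eq -(inj_eq enum_rank_inj) ip jp.
Qed.

Lemma jcells_linked p (i j : jcells p) : jlinked (val i) (val j).
Proof. by have /and3P[] := jcells_admissible i j. Qed.

Lemma jcells_size p (i : jcells p) : (p.2 < lam (val i))%N.
Proof. by have /and3P[] := jcells_admissible i i. Qed.

Definition jcell_basis p (i j : jcells p) : centralizer c :=
  Centralizer (jcell_cent_admissible (jcells_admissible i j)).

Lemma jcell_basisE p (i j : jcells p) i' s j' t :
  phi (val (jcell_basis i j)) i' s j' t =
  [&& i' == val i, j' == val j, t + p.2.+1 == lam (val j) + s & t < lam (val j)]%N%:R.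
Proof. by rewrite jcellE ?jcells_size ?jcells_linked. Qed.

(** The coefficient functional dual to [jcell_basis i j]: it reads the place of the only 1 in row 0
    of that cell. *)
Definition jpos p (i j : jcells p) (b : A) : k :=
  phi b (val i) 0 (val j) (lam (val j) - p.2.+1)%N.

Lemma jpos_basis p (i j i' j' : jcells p) :
  jpos i j (val (jcell_basis i' j')) = ((i == i') && (j == j'))%:R.
Proof.
rewrite /jpos jcell_basisE; congr (nat_of_bool _)%:R; rewrite -!val_eqE /=.
have := jcells_size j; case: eqP => //= _; case: eqP => //= ->; lia.
Qed.

(** The blocks determine the class, and the place of the 1 in row 0 determines the length. *)
Lemma jpos_basis_neq p q (i j : jcells p) (i' j' : jcells q) :
  p != q -> jpos i j (val (jcell_basis i' j')) = 0.
Proof.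
move=> pq; rewrite /jpos jcell_basisE; case: and4P => // -[/eqP ii' /eqP jj' /eqP l _].
case/eqP: pq; have := jcells_size j; have := jcells_size j'.
case: i j i' j' => [i i_p] [j j_p] [i' i_q] [j' j_q] /= in ii' jj' l *.
rewrite jj' in l *; rewrite ii' in i_p => l1 l2.
move: i_p i_q l l1 l2; case: p q {j_p j_q} => [g l1] [h l2] /=.
move=> /andP[/eqP <- _] /andP[/eqP <- _] eq_l lt1 lt2.
by congr (_, _); apply: val_inj => /=; lia.
Qed.

Lemma val_cell_combination (Q : pred jindex) r :
  val (cell_combination jcell_basis Q r) =
  \sum_(p | Q p) \sum_(i : jcells p) \sum_(j : jcells p) r p i j *: val (jcell_basis i j).
Proof.
rewrite raddf_sum; apply: eq_bigr => p _; rewrite raddf_sum; apply: eq_bigr => i _.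
by rewrite raddf_sum; apply: eq_bigr => j _.
Qed.

Lemma jpos_cell_combination (Q : pred jindex) r p (i j : jcells p) :
  jpos i j (val (cell_combination jcell_basis Q r)) = r p i j *+ Q p.
Proof.
have [F defF] : exists F : forall q, jcells q -> jcells q -> k,
    forall q i' j', jpos i j (val (jcell_basis i' j')) = F q i' j' by eexists.
have jpos_sum q : jpos i j (\sum_(i' : jcells q) \sum_(j' : jcells q)
      r q i' j' *: val (jcell_basis i' j')) =
    \sum_(i' : jcells q) \sum_(j' : jcells q) r q i' j' * F q i' j'.
  rewrite /jpos jcoord_sum; apply: eq_bigr => i' _.
  by rewrite jcoord_sum; apply: eq_bigr => j' _; rewrite jcoordZ -defF.
rewrite val_cell_combination [LHS]jcoord_sum (eq_bigr _ (fun q _ => jpos_sum q)).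
have Fp i' j' : F p i' j' = ((i == i') && (j == j'))%:R by rewrite -defF jpos_basis.
have Fneq q i' j' : q != p -> F q i' j' = 0.
  by move=> qp; rewrite -defF jpos_basis_neq // eq_sym.
have [Qp | nQp] := boolP (Q p); last first.
  rewrite big1 // => q Qq; rewrite big1 // => i' _; rewrite big1 // => j' _.
  by rewrite Fneq ?mulr0 //; apply: contraNneq nQp => <-.
rewrite (bigD1 p Qp) /= [X in _ + X]big1 => [|q /andP[_ qp]]; last first.
  by rewrite big1 // => i' _; rewrite big1 // => j' _; rewrite Fneq ?mulr0.
rewrite addr0 (bigD1 i) //= [X in _ + X]big1 => [|i' ii']; last first.
  by rewrite big1 // => j' _; rewrite Fp eq_sym (negPf ii') mulr0.
rewrite addr0 (bigD1 j) //= [X in _ + X]big1 => [|j' jj']; last first.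
  by rewrite Fp [j == _]eq_sym (negPf jj') andbF mulr0.
by rewrite addr0 Fp !eqxx mulr1.
Qed.

(** The free entries in [cent_ext] are the values of [jpos]: column [t] belongs to
    [l = lam j - t.+1], and [lam j <= t + lam i] then says [l < lam i]. *)
Lemma centralizer_ext (a b : centralizer c) :
  (forall p (i j : jcells p), jpos i j (val a) = jpos i j (val b)) -> a = b.
Proof.
move=> ab; apply: val_inj; apply: (@cent_ext _ _ _ S); try exact: centralizerP.
move=> i j t ij tj lij.
have l_lt : (lam j - t.+1 < \max_j lam j)%N.
  by apply: leq_trans (leq_bigmax j); lia.
pose p : jindex := (enum_rank (jlead i), Ordinal l_lt).
have ip : (enum_rank (jlead i) == p.1) && (p.2 < lam i)%N by rewrite eqxx /=; lia.
have jp : (enum_rank (jlead j) == p.1) && (p.2 < lam j)%N.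
  by rewrite (inj_eq enum_rank_inj) eq_sym jlead_eq ij /=; lia.
have := ab p (Sub i ip) (Sub j jp).
by rewrite /jpos /= (_ : lam j - (lam j - t.+1).+1 = t)%N //; lia.
Qed.

Lemma cell_combination_jpos (a : centralizer c) :
  a = cell_combination jcell_basis predT (fun p i j => jpos i j (val a)).
Proof.
by apply: centralizer_ext => p i j; rewrite jpos_cell_combination mulr1n.
Qed.

Lemma centralizer_cell_basis : cell_basis jcell_basis.
Proof.
split=> [a|r r0 p i j]; first by eexists; apply: cell_combination_jpos.
have := jpos_cell_combination predT r i j; rewrite r0 mulr1n => <-.
by rewrite /jpos jcoord0.
Qed.

Lemma jflip_commutes (b : centralizer c) : commutes_with c (jflip S (val b)).
Proof.
apply/eqP; have := congr1 (jflip S) (centralizerP b).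
by rewrite !jflipM jflipc => ->.
Qed.

Definition centralizer_flip (b : centralizer c) : centralizer c :=
  Centralizer (jflip_commutes b).

Fact centralizer_flip_linear : linear centralizer_flip.
Proof. by move=> r a b; apply: val_inj; rewrite /= jflip_linear. Qed.

HB.instance Definition _ := GRing.isLinear.Build k (centralizer c) (centralizer c)
  *:%R centralizer_flip centralizer_flip_linear.

Lemma centralizer_cell_involution : cell_involution jcell_basis centralizer_flip.
Proof.
split=> [|x y|x|p i j]; try apply: val_inj => /=.
- exact: jflip1.
- exact: jflipM.
- exact: jflipK.
apply: (@jcoord_inj _ _ _ S) => i' s j' t.
rewrite jflipE !jcell_basisE -mulrnA mulnb; congr (nat_of_bool _)%:R.
have := jcells_size i; have := jcells_size j.
by have [->|] := eqVneq i' (val j); have [->|] := eqVneq j' (val i) => //=; lia.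
Qed.

(** In the column read by [jpos u v], the cell has its 1 in row [p.2 - q.2], and no 1 if
    [q.2 > p.2]. This is the source of the triangularity of left multiplication. *)
Lemma jpos_mul_basis (a : A) p q (i j : jcells p) (u v : jcells q) :
  jpos u v (a * val (jcell_basis i j)) =
  phi a (val u) 0 (val i) (p.2 - q.2)%N *+ ((val v == val j) && (q.2 <= p.2)%N).
Proof.
have arith (L l l' x : nat) : (l < L)%N ->
    (L - l.+1 < L)%N && (L - l.+1 + l'.+1 == L + x)%N = (l <= l')%N && (x == l' - l)%N.
  by lia.
rewrite /jpos jcoordM; transitivity (\sum_m \sum_(x < lam m)
    ((m == val i) && (x == (p.2 - q.2)%N :> nat))%:R *
    (phi a (val u) 0 m x *+ ((val v == val j) && (q.2 <= p.2)%N))).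
  apply: eq_bigr => m _; apply: eq_bigr => x _.
  rewrite jcell_basisE mulr_natl mulr_natr -mulrnA mulnb; congr (_ *+ nat_of_bool _).
  case: (m == val i); case: (eqVneq (val v) (val j)) => [vj|_] /=; rewrite ?andbF //.
  by rewrite -vj [LHS]andbC [RHS]andbC (arith _ _ _ _ (jcells_size v)) andbC.
apply: etrans (sum_delta (fun m x => phi a (val u) 0 m x *+
  ((val v == val j) && (q.2 <= p.2)%N)) (val i) (p.2 - q.2)%N) _.
by rewrite (leq_ltn_trans (leq_subr _ _)) ?mulr1n ?jcells_size.
Qed.

Lemma jcells_val_eq p q (j : jcells p) (v : jcells q) : val v = val j -> q.1 = p.1.
Proof.
case: v j => [v vq] [j jp] /= vj; rewrite -vj in jp.
by case/andP: vq jp => /eqP <- _ /andP[/eqP <-].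
Qed.

(** By [jpos_mul_basis], a nonzero coefficient at [q] requires the class of [p] and [q.2 <= p.2],
    that is [q <= p]. For [q = p] it is an entry of [a] in row 0 and column 0, independent of
    [j]. *)
Lemma centralizer_cell_multiplication : cell_multiplication jcell_basis.
Proof.
move=> a p; exists (fun u i => phi (val a) (val u) 0 (val i) 0) => i j.
pose D := a * jcell_basis i j
  - \sum_(u : jcells p) phi (val a) (val u) 0 (val i) 0 *: jcell_basis u j.
exists (fun q u v => jpos u v (val D)); apply/eqP; rewrite addrC -subr_eq -/D.
apply/eqP/centralizer_ext => q u v; rewrite jpos_cell_combination.
have [// | nlt_qp] := boolP (q < p)%O; rewrite mulr0n.
have -> : jpos u v (val D) = jpos u v (val a * val (jcell_basis i j)) -
    \sum_(u' : jcells p) phi (val a) (val u') 0 (val i) 0 *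
      jpos u v (val (jcell_basis u' j)).
  rewrite /jpos rmorphB rmorphM jcoordB; congr (_ - _).
  rewrite raddf_sum jcoord_sum.
  by apply: eq_bigr => u' _; rewrite jcoordZ.
rewrite jpos_mul_basis; have [eq_qp | neq_qp] := eqVneq q p.
  move: u v; rewrite eq_qp => u v; rewrite leqnn subnn andbT.
  under [X in _ - X]eq_bigr => u' _ do rewrite jpos_basis.
  rewrite [X in _ - X](bigD1 u) //= [X in _ - (_ + X)]big1 => [|u' uu']; last first.
    by rewrite eq_sym (negPf uu') mulr0.
  by rewrite eqxx addr0 mulr_natr -val_eqE subrr.
rewrite [X in _ - X]big1 => [|u' _]; last by rewrite jpos_basis_neq ?mulr0.
rewrite subr0; case: andP => // -[/eqP/jcells_val_eq q1 q2].
by case/negP: nlt_qp; rewrite Order.ProdOrder.ltEprod neq_qp q1 Order.POrderTheory.lexx.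
Qed.

Theorem centralizer_cellular : cellular (centralizer c).
Proof.
exists _, jindex, jcells, jcell_basis, centralizer_flip; split.
- exact: centralizer_cell_basis.
- exact: centralizer_cell_involution.
exact: centralizer_cell_multiplication.
Qed.

End JordanCellular.

(** * Frobenius extension *)

Section FrobeniusDualBases.
Variables (A : nzRingType) (SB : pred A) (B : subNzRingType SB).
Variables (E : A -> B) (L : finType) (x y : L -> A).
Hypothesis ED : forall a b, E (a + b) = E a + E b.
Hypothesis EMl : forall (b : B) a, E (val b * a) = b * E a.
Hypothesis EMr : forall a (b : B), E (a * val b) = E a * b.
Hypothesis dual_l : forall a, \sum_l val (E (a * x l)) * y l = a.
Hypothesis dual_r : forall a, \sum_l x l * val (E (y l * a)) = a.

Let dual_basis (a : left_module B) :
  a = \sum_l E ((a : A) * x l) *: (y l : left_module B).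
Proof. by rewrite -[LHS]dual_l. Qed.

Let E0 : E 0 = 0.
Proof. by rewrite -(mul0r 0) -(rmorph0 (val : B -> A)) EMl mul0r. Qed.

Let E_sum (I : finType) (F : I -> A) : E (\sum_i F i) = \sum_i E (F i).
Proof. exact: (big_morph E ED E0). Qed.

Lemma dual_bases_finitely_generated : finitely_generated (left_module B).
Proof.
pose r := [seq (x l, y l) | l <- enum L].
exists [seq (z.2 : left_module B) | z <- r] => a.
exists (fun i => E ((a : A) * [seq z.1 | z <- r]`_i)).
pose F i := E ((a : A) * [seq z.1 | z <- r]`_i) *:
  [seq (z.2 : left_module B) | z <- r]`_i.
rewrite -(big_mkord xpredT F) size_map.
have {1}-> : a = \sum_(z <- r) E ((a : A) * z.1) *: (z.2 : left_module B).
  by rewrite [LHS]dual_basis big_map big_enum.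
rewrite (big_nth (0, 0)); apply: eq_big_nat => i /andP[_ ir].
by rewrite /F !(nth_map (0, 0)).
Qed.

(** Dual basis argument: preimages of the [f (y l)] are combined with the left linear coordinates
    [E (a * x l)]. *)
Lemma dual_bases_projective : projective (left_module B).
Proof.
move=> U V g f gV.
have /fin_all_exists[u gu] : forall l, exists u, g u = f (y l) by move=> l; apply: gV.
pose h0 (a : left_module B) : U := \sum_l E ((a : A) * x l) *: u l.
have h0_lin : linear h0.
  move=> b a a'; rewrite scaler_sumr -big_split; apply: eq_bigr => l _ /=.
  by rewrite scalerA -scalerDl -EMl mulrA -ED -mulrDl.
pose h : {linear left_module B -> U} :=
  HB.pack h0 (GRing.isLinear.Build B (left_module B) U *:%R h0 h0_lin).
exists h => a; transitivity (\sum_l E ((a : A) * x l) *: f (y l)).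
  by rewrite /= /h0 linear_sum; apply: eq_bigr => l _; rewrite linearZZ gu.
by rewrite [in RHS](dual_basis a) linear_sum; apply: eq_bigr => l _; rewrite linearZZ.
Qed.

Lemma dual_bases_frobenius_iso :
  exists Phi : A -> {linear left_module B -> B^o}, frobenius_iso Phi.
Proof.
pose Phi0 (a : A) (z : left_module B) : B^o := E ((z : A) * a).
have Phi0_lin a : linear (Phi0 a).
  by move=> b z z'; rewrite -[RHS]/(b * E (z * a) + E (z' * a)) -EMl -ED mulrA -mulrDl.
pose Phi a : {linear left_module B -> B^o} :=
  HB.pack (Phi0 a)
    (GRing.isLinear.Build B (left_module B) B^o *:%R (Phi0 a) (Phi0_lin a)).
exists Phi; split=> [a a' z|b a z|a b z|f].
- by rewrite /= /Phi0 mulrDr ED.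
- by rewrite /= /Phi0 mulrA.
- by rewrite /= /Phi0 mulrA EMr.
(* [dual_l] shows that this element represents [f]; [dual_r] shows that it is the only one. *)
exists (\sum_l x l * val (f (y l) : B)); split=> [z | a Phia].
  rewrite /= /Phi0 mulr_sumr E_sum [in RHS](dual_basis z) linear_sum.
  by apply: eq_bigr => l _; rewrite mulrA EMr linearZZ.
by rewrite -[RHS]dual_r; apply: eq_bigr => l _; rewrite -Phia.
Qed.

Lemma dual_bases_frobenius : frobenius_extension B.
Proof.
split; [exact: dual_bases_finitely_generated | exact: dual_bases_projective |].
exact: dual_bases_frobenius_iso.
Qed.

End FrobeniusDualBases.

(** * The Casimir trace onto the centralizer and its dual bases *)

Section JordanFrobenius.
Variables (k : fieldType) (A : algType k) (c : A) (S : jordan_coordinates c).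

Local Notation J := (jblock S).
Local Notation comp := (@jcomp _ _ _ S).
Local Notation lam := (@jsize _ _ _ S).
Local Notation ev := (@jeigen _ _ _ S).
Local Notation phi := (@jcoord _ _ _ S).
Local Notation N := (jnil S).

(** The idempotent of the class led by [g]; it is 0 if [g] is not a lead, so a sum over all [g] is a
    sum over classes. *)
Definition jcolor (g : J) : A := jdiag (fun i : J => (jlead i == g)%:R).

(* [a] sandwiched in the Casimir element of the algebra generated by [c] and the
   center.  This algebra is a product of algebras k[X]/(X^m), where m is the size
   of the largest block of a color [g]; the factor of [g] contributes the sum of
   the X^p (x) X^q with p + q = m - 1. *)
Definition jtrace (a : A) : A := \sum_(g : J) \sum_(p < lam g)
  N ^+ p * (jcolor g * a * jcolor g) * N ^+ (lam g - p.+1).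

Lemma jtraceD a b : jtrace (a + b) = jtrace a + jtrace b.
Proof.
rewrite -big_split; apply: eq_bigr => g _; rewrite -big_split; apply: eq_bigr => p _ /=.
by rewrite !(mulrDr, mulrDl).
Qed.

Lemma cent_color b g : b * c = c * b -> b * jcolor g = jcolor g * b.
Proof. by move=> bc; apply: (cent_diag bc) => i j; rewrite -jlead_eq => /eqP ->. Qed.

Lemma jtraceMl b a : b * c = c * b -> jtrace (b * a) = b * jtrace a.
Proof.
move=> bc; rewrite mulr_sumr; apply: eq_bigr => g _.
rewrite mulr_sumr; apply: eq_bigr => p _.
rewrite [RHS]mulrA; congr (_ * _); rewrite [RHS]mulrA (cent_nilX S bc) -[RHS]mulrA.
congr (_ * _).
by rewrite !mulrA (cent_color g bc).
Qed.

Lemma jtraceMr b a : b * c = c * b -> jtrace (a * b) = jtrace a * b.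
Proof.
move=> bc; rewrite mulr_suml; apply: eq_bigr => g _.
rewrite mulr_suml; apply: eq_bigr => p _.
rewrite -[RHS]mulrA -(cent_nilX S bc) [RHS]mulrA; congr (_ * _).
by rewrite -[RHS]mulrA; congr (_ * _); rewrite -[RHS]mulrA -(cent_color g bc) !mulrA.
Qed.

Lemma jtrace_coord a i s j t : phi (jtrace a) i s j t =
  (\sum_(p < lam (jlead i)) phi a i (s + p)%N j (t + p.+1 - lam (jlead i))%N
     *+ (lam (jlead i) <= t + p.+1)%N) *+ (jlinked i j && (t < lam j)%N).
Proof.
rewrite /jtrace jcoord_sum (bigD1 (jlead i)) //= [X in _ + X]big1 => [|g gi]; last first.
  rewrite jcoord_sum big1 // => p _.
  rewrite jcoordM_nilX jcoord_nilXM -mulrA jdiagM.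
  by rewrite eq_sym (negPf gi) mul0r mul0rn.
rewrite addr0 jcoord_sum -sumrMnl; apply: eq_bigr => p _.
rewrite jcoordM_nilX jcoord_nilXM jcoordM_diag jdiagM eqxx mul1r mulr_natl.
rewrite -!mulrnA !mulnb jlead_eq jlinked_sym.
have tp : (lam (jlead i) - p.+1 <= t)%N = (lam (jlead i) <= t + p.+1)%N by lia.
have [le_tp | lt_tp] := boolP (lam (jlead i) <= t + p.+1)%N; last first.
  by rewrite tp (negPf lt_tp) !andbF.
rewrite tp le_tp /=; congr (phi _ _ _ _ _ *+ _).
have := ltn_ord p; lia.
Qed.

(** Multiplying by [N] on one side or the other differs by a shift of [p] in the Casimir sum, and
    the end terms vanish since [N ^+ lam g] is 0 on the color [g]. *)
Lemma jtrace_cent a : commutes_with c (jtrace a).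
Proof.
apply/eqP/(@jcoord_inj _ _ _ S) => i s j t.
have [tj | tj] := leqP (lam j) t; first by rewrite !jcoord_outr.
rewrite jcoord_cM -[c in _ * c](subrK (@jdiag _ _ _ S ev)) mulrDr jcoordD.
rewrite jcoordM_diag addrC.
congr (_ + _).
  rewrite jtrace_coord; have [/andP[_ /eqP ->] //|] := boolP (jlinked i j).
  by rewrite mulr0n !mulr0.
case: t tj => [|t] tj; rewrite ?jcoordM_nil0 ?jcoordM_nil !jtrace_coord.
  (* In column 0 only the last [p] passes the guard, and row [s.+1 + p] is then outside block
     [i]. *)
  rewrite big1 ?mul0rn // => p _; case: leqP => // le_p.
  have [_ /(_ i (jlinked_refl i))] := jleadP i; have := ltn_ord p => p_lt lam_i.
  by rewrite jcoord_outl ?mul0rn //; lia.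
have [ij | ij] := boolP (jlinked i j); last by rewrite !mulr0n mul0rn.
have [_ max_i] := jleadP i.
have lam_i := max_i i (jlinked_refl i); have lam_j : (lam j <= lam (jlead i))%N.
  by apply: max_i; rewrite jlinked_sym.
rewrite tj (ltnW tj) !mulr1n; move: (lam (jlead i)) lam_i lam_j => m lam_i lam_j.
(* The two sides sum [G] over [p < m] and over [0 < p <= m]. [G m] is 0 because row [s + m] is
   outside block [i], and [G 0] because [t.+1 < lam j <= m]. *)
pose G p := phi a i (s + p)%N j (t.+1 + p - m)%N *+ (m <= t.+1 + p)%N.
transitivity (\sum_(p < m) G p).
  by apply: eq_bigr => p _; rewrite /G addSnnS.
transitivity (\sum_(p < m) G p.+1); last first.
  by apply: eq_bigr => p _; rewrite /G -addSnnS.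
transitivity (\sum_(p < m.+1) G p).
  by rewrite big_ord_recr /= /G [phi _ _ _ _ _]jcoord_outl ?mul0rn ?addr0 //; lia.
by rewrite big_ord_recl /= /G !addn0 [(m <= _)%N]leqNgt (leq_trans tj lam_j) add0r.
Qed.

Definition centralizer_trace (a : A) : centralizer c := Centralizer (jtrace_cent a).

Definition jdual_index : finType := (J * J * 'I_(\max_j lam j))%type.

(* A largest block [g] is free of rank 1 over k[X]/(X^m): matrix units into and out
   of it are dual to each other for the Frobenius form of k[X]/(X^m). *)
Definition jdual_left (l : jdual_index) : A :=
  junit l.1.2 l.2 l.1.1 0 *+ (jlead l.1.1 == l.1.1).

Definition jdual_right (l : jdual_index) : A := junit l.1.1 (lam l.1.1).-1 l.1.2 l.2.

Lemma jtrace0 : jtrace 0 = 0.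
Proof. by rewrite -[0](mul0r 0) jtraceMl ?mul0r ?mulr0. Qed.

Lemma jlinked_lead_size i g : jlinked i g -> jlead g = g -> (lam i <= lam g)%N.
Proof. by move=> ig {1}<-; have [_] := jleadP g; apply. Qed.

Lemma sum_jdual_index (F : k) g j t (f : jdual_index -> k) :
  ((lam j <= t)%N -> F = 0) ->
  (forall l, f l = F *+ [&& l.1.1 == g, l.1.2 == j & l.2 == t :> nat]) ->
  \sum_l f l = F.
Proof.
move=> F0 fE; rewrite (eq_bigr _ (fun l _ => fE l)).
have [tj | tj] := leqP (lam j) t.
  by rewrite F0 // big1 // => l _; rewrite mul0rn.
have t_lt : (t < \max_j lam j)%N by apply: leq_trans tj (leq_bigmax j).
rewrite (bigD1 (g, j, Ordinal t_lt)) //= !eqxx mulr1n big1 ?addr0 //.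
case=> [[g' j'] t']; rewrite -!pair_eqE /= /pair_eq /= -!pair_eqE /= /pair_eq -val_eqE /=.
by rewrite -andbA => /negPf ->.
Qed.

Lemma jtrace_dual_left a : \sum_l jtrace (a * jdual_left l) * jdual_right l = a.
Proof.
apply: (@jcoord_inj _ _ _ S) => i s j t; rewrite jcoord_sum.
apply: (@sum_jdual_index _ (jlead i) j t); first exact: jcoord_outr.
case=> [[g j'] t']; rewrite jcoordM_unit /jdual_left /=.
have [<- /=|] := eqVneq j j'; last by rewrite /= mulr0n mul0rn andbF.
have [<- /=|] := eqVneq t t'; last by rewrite /= mulr0n mul0rn !andbF.
rewrite andbT mulr1n; have [lead_g | not_lead] := eqVneq (jlead g) g; last first.
  rewrite mulr0n mulr0 jtrace0 jcoord0 mul0rn; case: eqP => // gi.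
  by rewrite gi jlead_id eqxx in not_lead.
rewrite mulr1n jtrace_coord -jlead_eq lead_g [g == _]eq_sym.
have [eq_g | _] /= := eqVneq (jlead i) g; last by rewrite mulr0n mul0rn.
rewrite eq_g mulr1n.
have ig : jlinked i g by rewrite -jlead_eq eq_g lead_g.
have := jlinked_lead_size ig lead_g; case/andP: ig => /eqP ig _.
have [gj | gj] := eqVneq (comp g) (comp j); last by rewrite jcoord_comp ?mul0rn // ig.
have [tj | tj] := ltnP t (lam j); last by rewrite jcoord_outr // mulr0n.
rewrite mulr1n; case lam_g : (lam g) => [|m] i_m.
  by rewrite mulr0n jcoord_outl //; lia.
(* The term [p] reads column [p] of [a * jdual_left l], where only column 0 is nonzero. *)
rewrite ltnSn mulr1n big_ord_recl /= big1 => [|p _].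
  by rewrite addn0 addn1 leqnn subnn jcoordM_unit gj lam_g !eqxx addr0.
by rewrite jcoordM_unit /= addnS subSS addKn /= andbF mulr0n !mul0rn.
Qed.

Lemma jtrace_dual_right a : \sum_l jdual_left l * jtrace (jdual_right l * a) = a.
Proof.
apply: (@jcoord_inj _ _ _ S) => i s j t; rewrite jcoord_sum.
apply: (@sum_jdual_index _ (jlead j) i s); first exact: jcoord_outl.
case=> [[g i'] s']; rewrite /jdual_left /=.
have [lead_g | not_lead] := eqVneq (jlead g) g; last first.
  rewrite mulr0n mul0r jcoord0; case: eqP => // gj.
  by rewrite gj jlead_id eqxx in not_lead.
rewrite mulr1n jcoord_unitM /=.
have [<- /=|] := eqVneq i i'; last by rewrite /= mulr0n mul0rn andbF.
have [ss /=|] := eqVneq s s'; last by rewrite /= mulr0n mul0rn !andbF.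
rewrite -ss andbT mulr1n jtrace_coord -jlead_eq lead_g.
have [eq_g | _] /= := eqVneq g (jlead j); last by rewrite mulr0n mul0rn.
have jg : jlinked j g by rewrite -jlead_eq -eq_g lead_g.
have := jlinked_lead_size jg lead_g; case/andP: jg => /eqP jg _.
have [gi | gi] := eqVneq (comp i) (comp g); last first.
  by rewrite mulr0n jcoord_comp // jg.
have [si | si] := ltnP s (lam i); last by rewrite mulr0n jcoord_outl.
have [tj | tj] := ltnP t (lam j); last by rewrite mulr0n jcoord_outr.
rewrite !mulr1n; case lam_g : (lam g) => [|m] j_m; first by lia.
(* The term [p] reads row [p] of [jdual_right l * a], where only the last row [m] is nonzero. *)
rewrite big_ord_recr /= big1 => [|p _].
  by rewrite add0r add0n addnK leq_addl jcoord_unitM gi lam_g !eqxx ltnSn -ss.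
by rewrite jcoord_unitM lam_g eqxx /= add0n ltn_eqF ?ltn_ord // mulr0n !mul0rn.
Qed.

Theorem centralizer_frobenius : frobenius_extension (centralizer c).
Proof.
apply: (@dual_bases_frobenius _ _ _ centralizer_trace jdual_index jdual_left jdual_right).
- by move=> a b; apply: val_inj; apply: jtraceD.
- by move=> b a; apply: val_inj; apply: jtraceMl; apply: centralizerP.
- by move=> a b; apply: val_inj; apply: jtraceMr; apply: centralizerP.
- exact: jtrace_dual_left.
exact: jtrace_dual_right.
Qed.

End JordanFrobenius.

(** * Separability *)

Section SeparableCentralizer.
Variables (k : fieldType) (A : algType k) (c : A).
Variables (G : finGroupType) (u : G -> A).
Hypothesis G_neq0 : #|G|%:R != 0 :> k.
Hypothesis u1 : u 1%g = 1.
Hypothesis uM : forall g h, u g * u h = u (g * h)%g.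
Hypothesis u_span : forall a, exists f : G -> k, a = \sum_g f g *: u g.

Local Notation "x (x) y" := (@pure_tensor A _ (centralizer c) x y) (at level 35).
Local Notation T := (@tensor A _ (centralizer c)).

Let balP := @pure_tensor_balanced A _ (centralizer c).

Lemma pure_tensor0l y : 0 (x) y = 0 :> T.
Proof.
by case: balP => Dl _ _; apply: (addrI (0 (x) y)); rewrite -Dl !addr0.
Qed.

Lemma pure_tensor0r x : x (x) 0 = 0 :> T.
Proof.
by case: balP => _ Dr _; apply: (addrI (x (x) 0)); rewrite -Dr !addr0.
Qed.

Lemma pure_tensor_suml (I : finType) (F : I -> A) y :
  (\sum_i F i) (x) y = \sum_i F i (x) y.
Proof.
case: balP => Dl _ _.
exact: (big_morph (fun x => x (x) y) (fun x1 x2 => Dl x1 x2 y) (pure_tensor0l y)).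
Qed.

Lemma pure_tensor_sumr (I : finType) (F : I -> A) x :
  x (x) (\sum_i F i) = \sum_i x (x) F i.
Proof.
case: balP => _ Dr _.
exact: (big_morph (fun y => x (x) y) (Dr x) (pure_tensor0r x)).
Qed.

(** Scalars belong to the centralizer. *)
Lemma pure_tensorZ r x y : (r *: x) (x) y = x (x) (r *: y).
Proof.
case: balP => _ _ balM; have := balM x (r%:A) y.
by rewrite linearZ rmorph1 -scalerAr mulr1 -scalerAl mul1r.
Qed.

Lemma tensor_lift0 (V : zmodType) (f : A -> A -> V) :
  balanced (centralizer c) f -> tensor_lift f (0 : T) = 0.
Proof.
by move=> fB; apply: (addrI (tensor_lift f (0 : T))); rewrite -tensor_liftD // !addr0.
Qed.

Lemma tensor_lift_sum (V : zmodType) (f : A -> A -> V) (I : finType) (F : I -> T) :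
  balanced (centralizer c) f ->
  tensor_lift f (\sum_i F i) = \sum_i tensor_lift f (F i).
Proof.
by move=> fB; apply: (big_morph _ (tensor_liftD fB) (tensor_lift0 fB)).
Qed.

Lemma balanced_lact a : balanced (centralizer c) (fun x y => (a * x) (x) y).
Proof.
by case: balP => Dl Dr balM; split=> *; rewrite ?mulrDr ?Dl ?Dr // mulrA balM.
Qed.

Lemma balanced_ract a : balanced (centralizer c) (fun x y => x (x) (y * a)).
Proof.
by case: balP => Dl Dr balM; split=> *; rewrite ?mulrDl ?Dl ?Dr // balM mulrA.
Qed.

Lemma balanced_mul : balanced (centralizer c) (fun x y : A => x * y).
Proof. by split=> *; rewrite ?mulrDl ?mulrDr ?mulrA. Qed.

Definition split_mul (a : A) : T :=
  \sum_g (a * (#|G|%:R^-1 *: u g)) (x) u (g^-1)%g.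

Lemma split_mul_additive : zmod_morphism split_mul.
Proof.
have [Dl _ _] := balP.
have split_mulD a b : split_mul (a + b) = split_mul a + split_mul b.
  by rewrite -big_split; apply: eq_bigr => g _; rewrite mulrDl Dl.
by move=> a b; apply: (addIr (split_mul b)); rewrite -split_mulD !subrK.
Qed.

HB.instance Definition _ := GRing.isZmodMorphism.Build A T split_mul split_mul_additive.

Lemma split_mulMl a x : split_mul (a * x) = tensor_lact a (split_mul x).
Proof.
rewrite [RHS](tensor_lift_sum _ (balanced_lact a)); apply: eq_bigr => g _.
by rewrite -mulrA (tensor_lift_pure (balanced_lact a)).
Qed.

Lemma split_mulMr x a : split_mul (x * a) = tensor_ract (split_mul x) a.
Proof.
rewrite [RHS](tensor_lift_sum _ (balanced_ract a)).
under [RHS]eq_bigr => g _ do rewrite (tensor_lift_pure (balanced_ract a)).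
have [f ->] := u_span a.
under [RHS]eq_bigr => g _ do rewrite mulr_sumr pure_tensor_sumr.
under [LHS]eq_bigr => g _ do rewrite mulr_sumr mulr_suml pure_tensor_suml.
rewrite exchange_big [RHS]exchange_big; apply: eq_bigr => h _ /=.
(* Replacing [g] by [h^-1 * g] absorbs [u h] on the left of the tensor and releases it on the
   right. *)
rewrite (reindex_inj (mulgI h^-1%g)); apply: eq_bigr => g _ /=.
rewrite -!scalerAr -!scalerAl scalerA mulrC -scalerA pure_tensorZ; congr (_ (x) (_ *: _)).
  by rewrite -mulrA uM mulKVg.
by rewrite uM invMg invgK.
Qed.

Lemma split_mulK x : tensor_mul (split_mul x) = x.
Proof.
rewrite [LHS](tensor_lift_sum _ balanced_mul).
rewrite (eq_bigr (fun=> #|G|%:R^-1 *: x)) => [|g _].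
  by rewrite sumr_const -scaler_nat scalerA mulfV // scale1r.
rewrite (tensor_lift_pure balanced_mul) -scalerAr -scalerAl -mulrA uM.
by rewrite mulgV u1 mulr1.
Qed.

Theorem centralizer_separable : separable_extension (centralizer c).
Proof.
by exists split_mul; split; [apply: split_mulMl | apply: split_mulMr | apply: split_mulK].
Qed.

End SeparableCentralizer.

Section GroupElements.
Variables (k : fieldType) (G : finGroupType).

Definition group_elt (g : G) : group_algebra k G := [ffun x => (x == g)%:R].

Lemma group_eltM g h : group_elt g * group_elt h = group_elt (g * h)%g.
Proof.
apply/ffunP => x; rewrite !ffunE (bigD1 g) //= big1 => [|y /negPf yg].
  by rewrite !ffunE eqxx mul1r addr0 -(can2_eq (mulKVg g) (mulKg g)) eq_sym.
by rewrite !ffunE yg mul0r.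
Qed.

Lemma group_elt_sum (a : group_algebra k G) : a = \sum_g a g *: group_elt g.
Proof.
apply/ffunP => x; rewrite sum_ffunE (bigD1 x) //= big1 => [|g gx].
  by rewrite !ffunE eqxx addr0 [_ *: _]mulr1.
by rewrite !ffunE eq_sym (negPf gx) scaler0.
Qed.

End GroupElements.

(** * Existence of Jordan coordinates *)

(** The columns [Q] are the coordinate functionals of the Jordan basis [P], read off from expansions
    of the rows of the identity; linear independence of [P] gives the duality. *)
Lemma exists_dual_jordan_basis (k : closedFieldType) n (c : 'M[k]_n) :
  exists (J : finType) (lam : J -> nat) (ev : J -> k)
    (P : J -> nat -> 'rV[k]_n) (Q : J -> nat -> 'cV[k]_n),
  [/\ forall i s j t, P i s *m Q j t = [&& i == j, s == t & (s < lam i)%N]%:R%:M,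
      \sum_j \sum_(s < lam j) Q j s *m P j s = 1%:M,
      forall j s, P j s *m c = ev j *: P j s + P j s.+1
    & forall j s, (lam j <= s)%N -> P j s = 0 /\ Q j s = 0].
Proof.
have [|J [lam [ev [v [_ P0 Pfree Pspan]]]]] := exists_jordan_basis (c := c) (W := 1%:M).
  exact: submx1.
pose P j s := v j *m (c - (ev j)%:M) ^+ s.
have /fin_all_exists[alpha alphaE] : forall l : 'I_n, exists alpha : J -> nat -> k,
    row l 1%:M = \sum_j \sum_(s < lam j) alpha j s *: P j s.
  by move=> l; apply/Pspan/submx1.
pose Q j s : 'cV[k]_n := \col_l (alpha l j s *+ (s < lam j)%N).
have Pout j s : (lam j <= s)%N -> P j s = 0.
  by move=> js; rewrite /P -(subnKC js) exprD -mulmxE mulmxA P0 mul0mx.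
have Qout j s : (lam j <= s)%N -> Q j s = 0.
  by move=> js; apply/colP => l; rewrite !mxE ltnNge js.
have QP1 : \sum_j \sum_(s < lam j) Q j s *m P j s = 1%:M.
  apply/row_matrixP => l; rewrite alphaE linear_sum; apply: eq_bigr => j _.
  rewrite linear_sum; apply: eq_bigr => s _ /=; rewrite row_mul.
  by rewrite [row l _]mx11_scalar mul_scalar_mx !mxE ltn_ord.
have PQ i s j t : P i s *m Q j t = [&& i == j, s == t & (s < lam i)%N]%:R%:M.
  have [si | si] := ltnP s (lam i); last first.
    by rewrite Pout // mul0mx !andbF raddf0.
  have [tj | tj] := ltnP t (lam j); last first.
    rewrite Qout // mulmx0; case: (eqVneq i j) => [ij|] /=; last by rewrite raddf0.
    by rewrite -ij in tj; rewrite ltn_eqF ?raddf0 // (leq_trans si).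
  (* Both [P i s *m Q j t] and the Kronecker delta are coefficients of an expansion of [P i s] in
     the basis. *)
  have : \sum_j \sum_(t < lam j)
      ((P i s *m Q j t) 0 0 - ((j == i) && (t == s :> nat))%:R) *: P j t = 0.
    under eq_bigr => m _ do under eq_bigr => u _ do rewrite scalerBl.
    under eq_bigr => m _ do rewrite sumrB.
    rewrite sumrB; apply/eqP; rewrite subr_eq0; apply/eqP; transitivity (P i s).
      rewrite -[RHS]mulmx1 -QP1 mulmx_sumr; apply: eq_bigr => m _.
      rewrite mulmx_sumr; apply: eq_bigr => u _.
      by rewrite mulmxA [P i s *m _ in RHS]mx11_scalar mul_scalar_mx.
    apply/rowP => z; rewrite summxE; transitivity (\sum_m \sum_(u < lam m)
        ((m == i) && (u == s :> nat))%:R * P m u 0 z).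
      by rewrite (sum_delta (fun m u => P m u 0 z)) si.
    apply: eq_bigr => m _; rewrite summxE; apply: eq_bigr => u _.
    by rewrite [RHS]mxE.
  move/(Pfree (fun j t => (P i s *m Q j t) 0 0 - ((j == i) && (t == s :> nat))%:R)).
  move/(_ j t tj)/eqP; rewrite subr_eq0 => /eqP PQ.
  by rewrite [LHS]mx11_scalar PQ andbT (eq_sym i) (eq_sym s).
exists J, lam, ev, P, Q; split=> // [j s|j s js]; last by rewrite Pout ?Qout.
rewrite -[c in LHS](subrK (ev j)%:M) mulmxDr mul_mx_scalar addrC.
by rewrite -mulmxA mulmxE -exprSr.
Qed.

(** The blocks of all factors are gathered in one sum type, and a block has zero vectors in every
    factor but its own. *)
Lemma exists_dual_jordan_bases (k : closedFieldType) (I : finType) (n : I -> nat)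
    (c : forall h, 'M[k]_(n h)) :
  exists (J : finType) (comp : J -> I) (lam : J -> nat) (ev : J -> k)
    (P : forall h, J -> nat -> 'rV[k]_(n h)) (Q : forall h, J -> nat -> 'cV[k]_(n h)),
  [/\ forall h i s j t, P h i s *m Q h j t =
        [&& comp i == h, i == j, s == t & (s < lam i)%N]%:R%:M,
      forall h, \sum_j \sum_(s < lam j) Q h j s *m P h j s = 1%:M,
      forall h j s, P h j s *m c h = ev j *: P h j s + P h j s.+1
    & forall h j s, (comp j != h) || (lam j <= s)%N -> P h j s = 0 /\ Q h j s = 0].
Proof.
have /fin_all_exists[J /fin_all_exists[lam /fin_all_exists[ev
  /fin_all_exists[P /fin_all_exists[Q PQ]]]]] := fun h => exists_dual_jordan_basis (c h).
exists {h : I & J h}, tag, (fun j => lam (tag j) (tagged j)),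
  (fun j => ev (tag j) (tagged j)),
  (fun h j s => untag 0 (fun j => P h j s) j),
  (fun h j s => untag 0 (fun j => Q h j s) j).
split=> [h [i1 i] s [j1 j] t|h|h [j1 j] s|h [j1 j] s] /=.
- have [PQh _ _ _] := PQ h; have [i1h|i1h] := eqVneq i1 h; last first.
    by rewrite untag_dflt // mul0mx raddf0.
  subst i1; have [j1h|j1h] := eqVneq j1 h; last first.
    rewrite [untag _ _ (existT _ j1 j)]untag_dflt // mulmx0.
    case: eqP => [/(congr1 tag) /= hj | _]; last by rewrite raddf0.
    by rewrite hj eqxx in j1h.
  subst j1; rewrite !untagE /= PQh; congr (nat_of_bool _)%:R%:M.
  by rewrite eq_Tagged.
- have [_ PQh _ _] := PQ h; rewrite -[RHS]PQh.
  pose F h' (j : J h') := \sum_(s < lam h' j)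
    untag 0 (fun j => Q h j s) (Tagged J j) *m untag 0 (fun j => P h j s) (Tagged J j).
  transitivity (\sum_h' \sum_(j : J h') F h' j).
    by rewrite [RHS](sig_big_dep (fun _ => true) (fun _ _ => true)); apply: eq_big => // -[].
  rewrite (bigD1 h) //= [X in _ + X]big1 ?addr0 => [|h' h'h]; last first.
    rewrite big1 // => j _; rewrite /F big1 // => s _.
    by rewrite untag_dflt // mul0mx.
  by apply: eq_bigr => j _; apply: eq_bigr => s _; rewrite !untagE.
- have [_ _ PQh _] := PQ h; have [j1h|j1h] := eqVneq j1 h; last first.
    by rewrite !untag_dflt // mul0mx scaler0 addr0.
  by subst j1; rewrite !untagE /= PQh.
have [_ _ _ PQh] := PQ h; have [j1h|j1h _] := eqVneq j1 h; last first.
  by rewrite !untag_dflt.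
by subst j1; rewrite !untagE => /PQh.
Qed.

Lemma exists_jordan_coordinates (k : closedFieldType) (A : algType k) (c : A)
    (I : finType) (n : I -> nat) (rho : forall h, A -> 'M[k]_(n h)) :
  (forall h r a b, rho h (r *: a + b) = r *: rho h a + rho h b) ->
  (forall h, rho h 1 = 1%:M) ->
  (forall h a b, rho h (a * b) = rho h a *m rho h b) ->
  (forall a, (forall h, rho h a = 0) -> a = 0) ->
  (forall X : forall h, 'M[k]_(n h), exists a, forall h, rho h a = X h) ->
  inhabited (jordan_coordinates c).
Proof.
move=> rhoP rho1 rhoM rho_inj rho_surj.
have [J [comp [lam [ev [P [Q [PQ QP Pc out]]]]]]] :=
  exists_dual_jordan_bases (fun h => rho h c).
pose phi a i s j t := (P (comp i) i s *m rho (comp i) a *m Q (comp i) j t) 0 0.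
(* Surjectivity of [rho] realizes prescribed coordinates; in the factor [h] only pairs of blocks of
   component [h] contribute. *)
have /choice[mat matE] : forall X : J -> nat -> J -> nat -> k, exists a, forall h,
    rho h a = \sum_i \sum_(s < lam i) \sum_j \sum_(t < lam j)
      X i s j t *: (Q h i s *m P h j t).
  by move=> X; apply: (rho_surj (fun h => _)).
have phi1 i s j t : phi 1 i s j t = [&& i == j, s == t & (s < lam i)%N]%:R.
  by rewrite /phi rho1 mulmx1 PQ eqxx mxE.
have mul11 (x y : 'M[k]_1) : (x *m y) 0 0 = x 0 0 * y 0 0 by rewrite mxE big_ord1.
have scalar1 (x : 'M[k]_1) : x = (x 0 0)%:M by exact: mx11_scalar.
exists; apply: (@JordanCoordinates _ _ _ J I comp lam ev phi mat) => //.
- move=> r a b i s j t; rewrite /phi rhoP mulmxDr mulmxDl -scalemxAr -scalemxAl.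
  by rewrite !mxE.
- move=> a b i s j t; rewrite /phi rhoM -[in LHS](mulmx1 (rho _ a)) -(QP (comp i)).
  rewrite !(mulmx_sumr, mulmx_suml) summxE; apply: eq_bigr => m _.
  rewrite !(mulmx_sumr, mulmx_suml) summxE; apply: eq_bigr => u _.
  have [mi | mi] := eqVneq (comp m) (comp i).
    rewrite mi !mulmxA -mulmxA -(mulmxA _ (P _ m u)).
    by rewrite mul11 !mulmxA.
  have [|-> ->] := out (comp i) m u; first by rewrite mi.
  by rewrite !(mulmx0, mul0mx) mxE mul0r.
- move=> a i s j t; rewrite /phi !negb_and => /or3P[ij | si | tj].
  + have [|_ ->] := out (comp i) j t; first by rewrite eq_sym ij.
    by rewrite mulmx0 mxE.
  + have [|-> _] := out (comp i) i s; first by rewrite leqNgt si orbT.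
    by rewrite !mul0mx mxE.
  have [|_ ->] := out (comp i) j t; first by rewrite leqNgt tj orbT.
  by rewrite mulmx0 mxE.
- move=> a b ab; apply/eqP; rewrite -subr_eq0; apply/eqP/rho_inj => h.
  have -> : a - b = (-1) *: b + a by rewrite scaleN1r addrC.
  rewrite rhoP scaleN1r addrC; apply/eqP; rewrite subr_eq0; apply/eqP.
  rewrite -[LHS]mul1mx -[RHS]mul1mx -[in LHS](QP h) -[in RHS](QP h) !mulmx_suml.
  apply: eq_bigr => i _; rewrite !mulmx_suml; apply: eq_bigr => s _.
  rewrite -[LHS]mulmx1 -[RHS]mulmx1 -[in LHS](QP h) -[in RHS](QP h) !mulmx_sumr.
  apply: eq_bigr => j _; rewrite !mulmx_sumr; apply: eq_bigr => t _.
  have [ih | ih] := eqVneq (comp i) h.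
    rewrite !mulmxA; congr (_ *m _); rewrite -!(mulmxA (Q h i s)); congr (_ *m _).
    by rewrite [LHS]scalar1 [RHS]scalar1; move: (ab i s j t); rewrite /phi ih => ->.
  by have [|-> _] := out h i s; [rewrite ih | rewrite mulmx0 !mul0mx].
- move=> X i s j t; rewrite /phi matE.
  pose G i' s' := \sum_j' \sum_(t' < lam j') ((j' == j) && (t' == t :> nat))%:R *
    (X i' s' j' t' *+ (comp i == comp j')).
  transitivity (\sum_i' \sum_(s' < lam i') ((i' == i) && (s' == s :> nat))%:R * G i' s').
    rewrite mulmx_sumr mulmx_suml summxE; apply: eq_bigr => i' _.
    rewrite mulmx_sumr mulmx_suml summxE; apply: eq_bigr => s' _; rewrite mulr_sumr.
    rewrite mulmx_sumr mulmx_suml summxE; apply: eq_bigr => j' _; rewrite mulr_sumr.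
    rewrite mulmx_sumr mulmx_suml summxE; apply: eq_bigr => t' _.
    rewrite -scalemxAr -scalemxAl mxE !mulmxA -(mulmxA (_ *m _)) mul11 !PQ !mxE eqxx.
    rewrite !mulr1n (eq_sym i) (eq_sym s) (eq_sym (comp j')) ltn_ord andbT.
    case: (eqVneq i' i) => [ii|_] /=; last by rewrite !mul0r mulr0.
    case: (eqVneq (s' : nat) s) => [ss|_] /=; last by rewrite !mul0r mulr0.
    have -> : (s < lam i)%N by rewrite -ss -ii.
    rewrite !mul1r; case: (comp i == comp j'); last by rewrite mulr0n !mulr0.
    by rewrite mulr1n mulrC.
  rewrite sum_delta /G (sum_delta (fun j' t' => X i s j' t' *+ _)) -!mulrnA !mulnb.
  congr (_ *+ nat_of_bool _).
  by case: (comp i == _); case: (s < _)%N; case: (t < _)%N.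
move=> i s j t; rewrite /phi rho1 !mulmx1 Pc mulmxDl -scalemxAl mxE.
by rewrite [X in X + _]mxE.
Qed.

Theorem corollary1p3 (G : finGroupType) (k : closedFieldType)
    (hchar : forall p : nat, p \in [pchar k] -> ~~ (p %| #|G|)%N)
    (c : group_algebra k G) :
  cellular (centralizer c) /\
  (separable_extension (centralizer c) /\ frobenius_extension (centralizer c)).
Proof.
have G_gt0 : (0 < #|G|)%N by apply/card_gt0P; exists 1%g.
have kG' : ([pchar k]^'.-nat #|G|)%N.
  by apply/pnatP => // p _ pG; apply/negP => /hchar/negP[].
have G_neq0 : #|G|%:R != 0 :> k by rewrite natf_neq0_pchar.
have [|I [n [rho [rho_inj rho_surj]]]] := @wedderburn k G.
  by rewrite /pgroup cardsT.
have [S] : inhabited (jordan_coordinates c).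
  apply: (@exists_jordan_coordinates _ _ c I n (fun h => group_algebra_op (rho h))) => //.
  - by move=> h r a b; apply: group_algebra_opP.
  - by move=> h; apply: group_algebra_op1.
  by move=> h a b; apply: group_algebra_opM.
split; first exact: centralizer_cellular S.
split; last exact: centralizer_frobenius S.
apply: (centralizer_separable c (u := @group_elt k G)) => //.
- exact: group_eltM.
by move=> a; exists a; apply: group_elt_sum.
Qed.
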